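(* Let $T\in(0,\infty)$, $\tau_0>0$, $D_0>0$, and let $\varrho$, $\ell$, $R$, $s$, $N$ and the generalized Gaussian function $\mathcal{G}$ be as defined in the context. Then $\mathcal{G}$ solves $$\frac{\partial\mathcal{G}}{\partial t}(x,t)-D_0\,\frac{\partial^2\mathcal{G}}{\partial x^2}(x,t)=\delta(t)\,\delta(x)-\mathcal{L}(x,t)\ \text{ on }\mathbb{R}^2,\qquad \mathcal{G}|_{t<0}=0,$$ with $$\mathcal{L}:=-a_0\,\varrho(s^2)-a_1\,\ell(s^2)-a_2\,\ell'(s^2)\quad (t>0),\qquad \mathcal L:=0\quad (t\le 0),$$ where $$a_0:=\frac{N}{\sqrt{\pi}}\,\frac{\sqrt{T}}{R^2}\left(\frac{2}{\tau_0}s^2-1\right)\left(R'-\frac{2\,T\,D_0}{\tau_0\,R}\right),$$ $$a_1:=\frac{N}{\sqrt{\pi}}\,\frac{\sqrt{T}}{R^2}\left[2\left(R'-\frac{2\,T\,D_0}{\tau_0\,R}\right)s^2+\frac{2\,T\,D_0}{R}\right],\qquad a_2:=\frac{N}{\sqrt{\pi}}\,\frac{4\,T^{3/2}D_0}{R^3}\,s^2.$$ If $\tau_0=1$ and, for some $t_0>0$, $$R(t)=\begin{cases}\sqrt{\frac{D_0T}{t_0^3}}\,(-t^2+3t_0t), & t\in[0,t_0],\\ \sqrt{4\,T\,D_0\,t}, & t>t_0,\end{cases}$$ then $a_0(\cdot,t)=0$ for $t\ge t_0$.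
   Context: The function $\varrho:\mathbb{R}\to\mathbb{R}$ is a relaxation function with $\operatorname{supp}(\varrho)=[0,T]$, i.e. it solves $\tau_0\varrho'+\varrho=-\tau_0\,\ell$ on $(0,\infty)$ with $\varrho(0)=1$, for the given relaxation time $\tau_0>0$ and a control term $\ell$ with $\int_0^T e^{s/\tau_0}\ell(s)\,ds=1$. The function $\ell$ is extended by $\ell(t)=0$ for $t<0$ and $\ell(0):=\ell(0+)$. Set $N:=\sqrt{\pi}\,\big/\int_{-\sqrt{T}}^{\sqrt{T}}\varrho(s^2)\,ds$. The function $R:[0,\infty)\to\mathbb{R}$ is an increasing $C^1$ function with $R(0)=0$, $R(t)>0$ for $t>0$, $\lim_{t\to\infty}R(t)=\infty$ and $R'(t)\in(0,c_0]$ for $t\in[0,\infty)$, where $c_0>0$ is a constant (so $R(t)\le c_0t$). Put $s=s(x,t):=\frac{\sqrt{T}\,x}{R(t)}$ for $t>0$. The generalized Gaussian function induced by $\varrho$ and $s$ is $$\mathcal{G}(\cdot,t):=\begin{cases}\frac{N}{\sqrt{\pi}}\,\frac{\partial s}{\partial x}(\cdot,t)\,\varrho(s^2(\cdot,t)), & t>0,\\ 0, & t\le 0.\end{cases}$$ The functions $a_0,a_1,a_2$ depend on $(x,t)$ through $s(x,t)$, $R(t)$, $R'(t)$. $\delta$ is the Dirac distribution and the differential equation is understood in the sense of distributions. *)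

(* Defs.v *)
From HB Require Import structures.
From mathcomp Require Import all_boot all_order all_algebra.
From mathcomp Require Import all_classical all_reals all_analysis.

Set Implicit Arguments.
Unset Strict Implicit.
Unset Printing Implicit Defensive.

Import Order.TTheory GRing.Theory Num.Theory.
Import numFieldNormedType.Exports.

Local Open Scope classical_set_scope.
Local Open Scope ring_scope.

(* Functions on the plane are curried, space variable first: u x t. *)

Definition partial_x (R : realType) (u : R -> R -> R) : R -> R -> R :=
  fun x t => derive1 (fun y => u y t) x.

Definition partial_t (R : realType) (u : R -> R -> R) : R -> R -> R :=
  fun x t => derive1 (u x) t.

Fixpoint Ck2 (R : realType) (k : nat) (u : R -> R -> R) : Prop :=
  continuous (fun p : R * R => u p.1 p.2) /\
  if k is k'.+1 then
    [/\ forall x t, derivable (fun y => u y t) x 1,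
        forall x t, derivable (u x) t 1,
        Ck2 k' (partial_x u) & Ck2 k' (partial_t u)]
  else True.

Definition test_function (R : realType) (phi : R -> R -> R) : Prop :=
  (forall k, Ck2 k phi) /\
  compact (closure [set p : R * R | phi p.1 p.2 != 0]).

Definition plane_measure (R : realType) :=
  ((@lebesgue_measure R) \x (@lebesgue_measure R))%E.

Definition locally_integrable2 (R : realType) (u : R -> R -> R) : Prop :=
  measurable_fun setT (fun p : R * R => u p.1 p.2) /\
  forall K : set (R * R), compact K ->
    (\int[@plane_measure R]_(p in K) `|u p.1 p.2|%:E < +oo)%E.

(* Functionals on test functions; only their values at phi with
   [test_function phi] matter. *)
Definition functional2 (R : realType) := (R -> R -> R) -> R.

Definition regular_dist (R : realType) (u : R -> R -> R) : functional2 R :=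
  fun phi => \int[@plane_measure R]_p (u p.1 p.2 * phi p.1 p.2).

Definition dist_dx (R : realType) (F : functional2 R) : functional2 R :=
  fun phi => - F (partial_x phi).

Definition dist_dt (R : realType) (F : functional2 R) : functional2 R :=
  fun phi => - F (partial_t phi).

Definition dirac_origin (R : realType) : functional2 R := fun phi => phi 0 0.

(* Functionals on functions of the space variable: pairings at a fixed time. *)
Definition regular_dist1 (R : realType) (f : R -> R) : (R -> R) -> R :=
  fun psi => \int[lebesgue_measure]_x (f x * psi x).

(* The composition f'(h) of the distributional derivative f' of a locally
   integrable function f with a smooth function h, given by the chain rule
   f'(h) = (f o h)' / h':
     <f'(h), psi> = - int f(h(x)) (psi / h')'(x) dx.
   The argument psi has to vanish at the zeros of h' to such an order that
   psi / h', with the library's value 0 at these zeros, is differentiable.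
   This is the case below: h' is proportional to x and psi carries a factor
   x^2. *)
Definition deriv_comp_dist (R : realType) (f h : R -> R) : (R -> R) -> R :=
  fun psi =>
    - \int[lebesgue_measure]_x (f (h x) * derive1 (fun y => psi y / derive1 h y) x).

(* Absolute continuity on [a, b]; s lists pairwise non-overlapping intervals
   [p.1, p.2]. *)
Definition abs_continuous (R : realType) (a b : R) (f : R -> R) : Prop :=
  forall e : R, 0 < e -> exists2 d : R, 0 < d &
    forall s : seq (R * R),
      all (fun p => [&& a <= p.1, p.1 <= p.2 & p.2 <= b]) s ->
      pairwise (fun p q => (p.2 <= q.1) || (q.2 <= p.1)) s ->
      \sum_(p <- s) (p.2 - p.1) < d ->
      \sum_(p <- s) `|f p.2 - f p.1| < e.

Definition control_term (R : realType) (T tau0 : R) (ell : R -> R) : Prop :=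
  [/\ locally_integrable setT ell,
      forall t, t < 0 -> ell t = 0,
      ell t @[t --> 0^'+] --> ell 0 &
      \int[lebesgue_measure]_(t in `[0, T]) (expR (t / tau0) * ell t) = 1].

(* As ell is only locally integrable (it may jump, for instance at T), the
   initial value problem is solved in the sense of Caratheodory. *)
Definition relaxation_function (R : realType) (T tau0 : R) (ell rho : R -> R)
    : Prop :=
  [/\ closure [set t | rho t != 0] = `[0, T]%classic,
      rho 0 = 1,
      forall b, 0 < b -> abs_continuous 0 b rho &
      {ae lebesgue_measure, forall t : R, 0 < t ->
         derivable rho t 1 /\
         tau0 * derive1 rho t + rho t = - tau0 * ell t}].

(* f is C^1 on [0, +oo[ (one-sided at 0) with derivative df there; the values
   of f and df on ]-oo, 0[ are irrelevant. *)
Definition C1_halfline (R : realType) (f df : R -> R) : Prop :=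
  [/\ {within `[0, +oo[, continuous df},
      forall t : R, 0 < t -> is_derive t 1 f (df t) &
      (f h - f 0) / h @[h --> 0^'+] --> df 0].

(* The increasing function R with R' in ]0, c0], written r. *)
Definition radius_function (R : realType) (c0 : R) (r : R -> R) : Prop :=
  [/\ {in `[0, +oo[ &, {homo r : t u / t < u}},
      r 0 = 0,
      forall t, 0 < t -> 0 < r t,
      r t @[t --> +oo] --> +oo &
      exists2 dr : R -> R, C1_halfline r dr &
        forall t, 0 <= t -> 0 < dr t <= c0].

Definition profile_integral (R : realType) (T : R) (rho : R -> R) : R :=
  \int[lebesgue_measure]_(y in `[- Num.sqrt T, Num.sqrt T]) rho (y ^+ 2).

Definition normalization (R : realType) (T : R) (rho : R -> R) : R :=
  Num.sqrt pi / profile_integral T rho.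

Definition similarity (R : realType) (T : R) (r : R -> R) (x t : R) : R :=
  Num.sqrt T * x / r t.

Definition gen_gauss (R : realType) (T : R) (rho r : R -> R) (x t : R) : R :=
  if 0 < t then
    normalization T rho / Num.sqrt pi * partial_x (similarity T r) x t
      * rho (similarity T r x t ^+ 2)
  else 0.

(* In the coefficients derive1 r is the ordinary two-sided derivative; they are
   used for t > 0 only. *)
Definition coef_a0 (R : realType) (T tau0 D0 : R) (rho r : R -> R) (x t : R)
    : R :=
  normalization T rho / Num.sqrt pi * (Num.sqrt T / r t ^+ 2)
    * (2 / tau0 * similarity T r x t ^+ 2 - 1)
    * (derive1 r t - 2 * T * D0 / (tau0 * r t)).

Definition coef_a1 (R : realType) (T tau0 D0 : R) (rho r : R -> R) (x t : R)
    : R :=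
  normalization T rho / Num.sqrt pi * (Num.sqrt T / r t ^+ 2)
    * (2 * (derive1 r t - 2 * T * D0 / (tau0 * r t)) * similarity T r x t ^+ 2
       + 2 * T * D0 / r t).

Definition coef_a2 (R : realType) (T D0 : R) (rho r : R -> R) (x t : R) : R :=
  normalization T rho / Num.sqrt pi * (4 * T `^ (3 / 2) * D0 / r t ^+ 3)
    * similarity T r x t ^+ 2.

(* <L(., t), psi> for t > 0. *)
Definition atten_slice (R : realType) (T tau0 D0 : R) (ell rho r : R -> R)
    (t : R) : (R -> R) -> R :=
  let h := fun x => similarity T r x t ^+ 2 in
  fun psi =>
    - regular_dist1 (fun x => rho (h x))
        (fun x => coef_a0 T tau0 D0 rho r x t * psi x)
    - regular_dist1 (fun x => ell (h x))
        (fun x => coef_a1 T tau0 D0 rho r x t * psi x)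
    - deriv_comp_dist ell h
        (fun x => coef_a2 T D0 rho r x t * psi x).

(* L as a distribution on the plane. L is of order r(t)^-3 on |x| < r(t), so
   it is not locally integrable at the origin; because of cancellation in x,
   however, <L(., t), phi(., t)> is bounded as t -> 0+. Hence the pairing is
   the integral over t > 0 of the spatial pairings. *)
Definition atten_dist (R : realType) (T tau0 D0 : R) (ell rho r : R -> R)
    : functional2 R :=
  fun phi => \int[lebesgue_measure]_(t in `]0, +oo[)
    atten_slice T tau0 D0 ell rho r t (fun x => phi x t).

(* The pairing [atten_dist] only involves absolutely convergent integrals. *)
Definition atten_well_defined (R : realType) (T tau0 D0 : R)
    (ell rho r : R -> R) : Prop :=
  (forall t, 0 < t ->
     locally_integrable setT (fun x => rho (similarity T r x t ^+ 2)) /\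
     locally_integrable setT (fun x => ell (similarity T r x t ^+ 2))) /\
  (forall phi, test_function phi ->
     lebesgue_measure.-integrable `]0, +oo[
       (fun t => (atten_slice T tau0 D0 ell rho r t (fun x => phi x t))%:E)).

(* Main.v *)
Require Import Defs.
From HB Require Import structures.
From mathcomp Require Import all_boot all_order all_algebra.
From mathcomp Require Import all_classical all_reals all_analysis.
From mathcomp Require Import measurable_realfun.
From mathcomp Require Import lra ring.

(** Write [c] for the normalizing constant, [s = sqrt T] and
    [P y = c * rho (y ^ 2)], a compactly supported density of total mass one.
    For [t > 0] the generalized Gaussian is the self-similar kernel
    [P (s * x / r t) * (s / r t)]. In the variable [y = s * x / r t], each time
    slice of it is the fixed density [P], and the whole plane [t > 0] is swept
    by the curves [x = r t * y / s], all of which start at the origin.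

    A kernel of this form satisfies [G_t = - (r' / r) * (x * G)_x] for [t > 0].
    The attenuation term is chosen so that, at every fixed time, it equals
    [(r' / r) * (x * G)_x + D0 * G_xx] in the sense of distributions in [x].
    This is [atten_sliceE]. Its coefficients come from the chain rule for [rho]
    composed with a square and from the relaxation equation; since [ell] is
    only locally integrable, the chain rule is used in the weak form
    [control_square_moment]. The weak form rests on three facts: [rho] is the
    integral of its derivative, because an absolutely continuous function whose
    derivative is zero almost everywhere is constant
    ([abs_continuous_derive0], [abs_continuous_FTC2]); the substitution
    [u = a * x ^ 2] is admissible for measurable integrands
    ([ge0_integral_change_of_variables], proved by uniqueness of the Lebesgue
    measure); and a primitive can be integrated by parts against a
    continuously differentiable function ([integral_by_parts_primitive], by
    Fubini's theorem).

    Testing the equation with [phi], the diffusion terms cancel, and what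
    remains is minus the integral over [t > 0] and [y] of [P y] times the
    derivative of [phi (r t * y / s) t] with respect to [t]
    ([transport_identity]). For every [y] the integral over [t] is
    [- phi 0 0], and [P] has mass one: this is the Dirac term. *)

Import Order.TTheory GRing.Theory Num.Theory.
Import numFieldNormedType.Exports.

Local Open Scope classical_set_scope.
Local Open Scope ring_scope.

Local Notation mu := lebesgue_measure.

(** * Absolutely continuous functions with almost everywhere zero derivative *)

(** The supremum of the points that can be reached from [a] can itself be
    reached, and cannot lie before [b]: local validity at this point lets one
    jump over it. *)
Lemma additive_intervalP (R : realType) (a b : R) (P : R -> R -> Prop) :
  a <= b ->
  (forall x y z, a <= x -> x <= y -> y <= z -> z <= b ->
     P x y -> P y z -> P x z) ->
  (forall c, a <= c -> c <= b -> exists2 d, 0 < d &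
     forall x y, a <= x -> y <= b -> c - d < x -> x <= c -> c <= y ->
       y < c + d -> P x y) ->
  P a b.
Proof.
move=> ab Ptrans Ploc.
pose S := [set x | [/\ a <= x, x <= b & P a x]].
have Sa : S a.
  have [d d0 Pd] := Ploc a (lexx a) ab.
  by split => //; apply: Pd => //; lra.
have supS : has_sup S by split; [exists a|exists b => x []].
pose c := sup S.
have ac : a <= c by apply: ub_le_sup; [case: supS|].
have cb : c <= b by apply: ge_sup; [case: supS|move=> x []].
have [d d0 Pd] := Ploc c ac cb.
have [x [ax xb Pax] cdx] := sup_adherent d0 supS.
have xc : x <= c by apply: ub_le_sup; [case: supS|].
have [->|/eqP cNb] := eqVneq b c.
  by apply: (Ptrans _ x) => //; apply: Pd => //; lra.
pose y := Num.min b (c + d / 2).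
have cy : c < y.
  by rewrite lt_min; apply/andP; split; [rewrite lt_neqAle cb andbT;
    apply/eqP => h; apply: cNb|lra].
have yb : y <= b by rewrite ge_min lexx.
have ycd : y < c + d by rewrite gt_min; apply/orP; right; lra.
have Sy : S y.
  split=> //; first by lra.
  by apply: (Ptrans _ x) => //; [lra|apply: Pd => //; lra].
have : y <= c by apply: ub_le_sup; [case: supS|].
lra.
Qed.

(** The exceptional null set, together with the end points, is covered by an
    open set [U] of measure below the [d] given by absolute continuity for [e].
    A short interval at a point outside [U] changes [f] by at most [e] times
    its length, since the derivative is zero there; short intervals at points
    of [U] lie in [U], so all of them together change [f] by at most [e]. The
    property [P] below records both contributions and is additive. *)
Lemma abs_continuous_derive0 (R : realType) (a b : R) (f : R -> R) :
  a <= b -> abs_continuous a b f ->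
  {ae lebesgue_measure, forall t : R, a < t -> t < b -> is_derive t 1 f 0} ->
  f b = f a.
Proof.
move=> ab acf [N [mN N0 subN]].
suff H : forall e : R, 0 < e -> `|f b - f a| <= e * (b - a + 1).
  apply/eqP; rewrite -subr_eq0 -normr_le0; apply/ler_addgt0Pl => e e0.
  have ba0 : 0 < b - a + 1 by lra.
  have := H (e / (b - a + 1)); rewrite divr_gt0// => /(_ isT).
  by rewrite divfK ?gt_eqF// addr0.
move=> e e0; have [d d0 fd] := acf e e0.
pose N' := N `|` ([set a] `|` [set b]).
have mN' : measurable N' by apply: measurableU => //; exact: measurableU.
have N'0 : mu N' = 0%E.
  by apply: null_set_setU => //; [exact: measurableU|apply: null_set_setU =>
    //; exact: lebesgue_measure_set1].
have N'fin : (@lebesgue_measure R N' < +oo)%E by rewrite [lebesgue_measure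
  _]N'0.
have [U [oU N'U muU]] := @lebesgue_regularity_outer R N' d mN' N'fin d0.
have mU : measurable U by exact: open_measurable.
have {}muU : (mu U < d%:E)%E.
  apply: le_lt_trans muU.
  rewrite -[in leLHS](setDUK N'U) (le_trans (measureU2 _ _ _))//.
    exact: measurableD.
  by rewrite [X in (X + _ <= _)%E]N'0 add0e.
pose P x y := exists s : seq (R * R),
  [/\ all (fun p => [&& x <= p.1, p.1 <= p.2 & p.2 <= y]) s,
      pairwise (fun p q => (p.2 <= q.1) || (q.2 <= p.1)) s,
      ((\sum_(p <- s) (p.2 - p.1))%:E <= mu (U `&` `]x, y]))%E &
      `|f y - f x| <= e * (y - x) + \sum_(p <- s) `|f p.2 - f p.1|].
have [s [sab ps sU fab]] : P a b.
  apply: additive_intervalP => //.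
  - move=> x y z ax xy yz zb [s [sxy ps sU fs]] [t [tyz pt tU ft]].
    exists (s ++ t); split.
    + rewrite all_cat; apply/andP; split.
        by apply: sub_all sxy => p /and3P[-> -> py] /=; exact: le_trans yz.
      by apply: sub_all tyz => p /and3P[yp -> ->]; rewrite (le_trans xy yp).
    + rewrite pairwise_cat ps pt !andbT.
      apply/allrelP => p q /(allP sxy)/and3P[_ _ py] /(allP tyz)/and3P[yq _ _].
      by rewrite (le_trans py yq).
    + rewrite (_ : `]x, z]%classic = `]x, y]%classic `|` `]y, z]%classic);
        last first.
        by rewrite -itv_bndbnd_setU// bnd_simp.
      rewrite setIUr measureU.
      * by rewrite big_cat/= EFinD leeD.
      * by apply: measurableI.
      * by apply: measurableI.
      * rewrite setIACA (_ : _ `&` `]y, z] = set0) ?setI0//.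
        by apply/seteqP; split => // w []/=;
          rewrite !in_itv/= => /andP[_ wy] /andP[]; lra.
    + rewrite big_cat/= (_ : f z - f x = (f y - f x) + (f z - f y));
        last by ring.
      by rewrite (le_trans (ler_normD _ _))// (le_trans (lerD fs ft))//; lra.
  - move=> c ac cb; have [cU|cU] := pselect (U c).
      have /nbhs_ballP[w /= w0 wU] : nbhs c U by exact: open_nbhs_nbhs.
      exists w => // x y ax yb cwx xc cy ycw.
      exists [:: (x, y)]; split=> /=.
      + by rewrite !lexx (le_trans xc cy).
      + by [].
      + rewrite big_seq1/= (_ : U `&` _ = `]x, y]%classic).
          rewrite lebesgue_measure_itv/= lte_fin; case: ltP => // yx.
          by rewrite lee_fin subr_le0.
        apply/setIidPr => v /=; rewrite in_itv/= => /andP[xv vy]; apply: wU.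
        by rewrite /ball/= ltr_norml; apply/andP; split; lra.
      + by rewrite big_seq1/=; apply: ler_wpDl => //; apply: mulr_ge0;
          [exact: ltW|lra].
    have ca : c != a by apply/eqP => h; apply: cU; apply: N'U; right; left;
      exact: h.
    have cb' : c != b by apply/eqP => h; apply: cU; apply: N'U; right; right;
      exact: h.
    have dc : is_derive c 1 f 0.
      apply: contrapT => h; apply: cU; apply: N'U; left; apply: subN => /= hh;
        apply: h.
      by apply: hh; rewrite lt_neqAle ?cb' 1?eq_sym ?ca.
    have fc : h^-1 *: (f (h *: 1 + c) - f c) @[h --> (0:R)^'] --> (0:R).
      have [h hd] := dc.
      by have : h^-1 *: (f (h *: 1 + c) - f c) @[h --> (0:R)^'] -->
        'D_1 f c by []; rewrite hd.
    move/cvgrPdist_le : fc => /(_ e e0);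
      rewrite near_withinE => /nbhs_ballP[w /= w0 wf].
    have {}wf v : `|v - c| < w -> `|f v - f c| <= e * `|v - c|.
      move=> vc; have [->|vNc] := eqVneq v c;
        first by rewrite !subrr normr0 mulr0.
      have vc0 : v - c != 0 by rewrite subr_eq0.
      have := wf (v - c); rewrite /ball/= sub0r normrN => /(_ vc vc0).
      rewrite sub0r normrN [(v - c)%:A]mulr1 subrK [(v - c)^-1 *: _](_ : _ = (v
        - c)^-1 * (f v - f c))//.
      by rewrite normrM normfV mulrC ler_pdivrMr// normr_gt0.
    exists w => // x y ax yb cwx xc cy ycw.
    exists [::]; rewrite !big_nil; split => //=.
    rewrite addr0 (_ : f y - f x = (f y - f c) - (f x - f c)); last by ring.
    rewrite (le_trans (ler_normB _ _))//.
    have h1 := wf y; have h2 := wf x.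
    rewrite (@ger0_norm _ (y - c)) ?subr_ge0// in h1.
    rewrite (distrC x c) (@ger0_norm _ (c - x)) ?subr_ge0// in h2.
    have := lerD (h1 ltac:(lra)) (h2 ltac:(lra)); lra.
rewrite (le_trans fab)//.
suff : \sum_(p <- s) `|f p.2 - f p.1| < e by move=> ?; lra.
apply: fd => //; rewrite -lte_fin; apply: le_lt_trans muU; apply: le_trans sU _.
by apply: le_measure; rewrite ?inE//; exact: measurableI.
Qed.

(** * The fundamental theorem of calculus for absolutely continuous functions *)

Definition interval_union (R : realType) (s : seq (R * R)) : set R :=
  \big[setU/set0]_(p <- s) `]p.1, p.2]%classic.

Lemma interval_unionP (R : realType) (s : seq (R * R)) (f : R -> R) :
  mu.-integrable setT (EFin \o f) ->
  all (fun p => p.1 <= p.2) s ->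
  pairwise (fun p q => (p.2 <= q.1) || (q.2 <= p.1)) s ->
  [/\ measurable (interval_union R s),
      mu (interval_union R s) = (\sum_(p <- s) (p.2 - p.1))%:E &
      \sum_(p <- s) `|\int[mu]_(x in `]p.1, p.2]) f x| <=
        \int[mu]_(x in interval_union R s) `|f x|].
Proof.
move=> intf; rewrite /interval_union; elim: s => [|p s IH] /=.
  by rewrite !big_nil measure0 Rintegral_set0.
move=> /andP[p12 /IH{}IH] /andP[ps /IH[mA muA IA]]; rewrite !big_cons.
set A := \big[setU/set0]_(p <- s) _ in mA muA IA *.
have dis : [disjoint `]p.1, p.2]%classic & A].
  apply/disj_setPS => x [/=]; rewrite in_itv/= => /andP[px xp].
  rewrite /A -bigcup_seq => -[q /= qs]; rewrite in_itv/= => /andP[qx xq].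
  by have /orP[] := allP ps _ qs; rewrite leNgt => /negP[];
    [exact: lt_le_trans xp|exact: lt_le_trans xq].
have intn : mu.-integrable setT (EFin \o (fun x =>
  `|f x|)) by exact: integrable_norm.
split; first exact: measurableU.
- rewrite measureU//; last by apply/eqP; rewrite -disj_set2E.
  have mup : mu `]p.1, p.2] = (p.2 - p.1)%:E.
    rewrite lebesgue_measure_itv/= lte_fin.
    by case: ltgtP p12 => // -> _; rewrite subrr.
  by rewrite [X in (_ + X)%E]muA [X in (X + _)%E]mup EFinD.
- rewrite Rintegral_setU//; last by apply: integrableS intn => //;
    exact: measurableU.
  apply: lerD IA; apply: le_normr_Rintegral => //.
  exact: integrableS intf.
Qed.

Lemma abs_continuousB (R : realType) (a b : R) (f g : R -> R) :
  abs_continuous a b f -> abs_continuous a b g ->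
  abs_continuous a b (fun x => f x - g x).
Proof.
move=> fac gac e e0; have e20 : 0 < e / 2 by lra.
have [d1 d10 h1] := fac _ e20; have [d2 d20 h2] := gac _ e20.
exists (Num.min d1 d2); first by rewrite lt_min d10.
move=> s sab ps; rewrite lt_min => /andP[s1 s2].
have := ltrD (h1 s sab ps s1) (h2 s sab ps s2).
rewrite -splitr; apply: le_lt_trans; rewrite -big_split/=;
  apply: ler_sum => p _.
rewrite (_ : _ - _ = (f p.2 - f p.1) - (g p.2 - g p.1)); last by ring.
exact: ler_normB.
Qed.

Lemma abs_continuous_integral (R : realType) (a b : R) (g : R -> R) :
  mu.-integrable setT (EFin \o g) ->
  abs_continuous a b (fun x => \int[mu]_(t in `[a, x]) g t).
Proof.
move=> intg e e0; have [d [d0 gd]] := integral_normr_continuous intg e0.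
exists d => // s sab ps sd.
have s12 : all (fun p => p.1 <= p.2) s by apply: sub_all sab => p /and3P[].
have [mA muA] := interval_unionP _ _ _ intg s12 ps.
rewrite (eq_big_seq (fun p => `|\int[mu]_(t in `[a,
  p.2]) g t - \int[mu]_(t in `[a, p.1]) g t|)).
  move/le_lt_trans; apply; apply: gd => //.
  by rewrite [X in (X < _)%E]muA lte_fin.
move=> p /(allP sab)/and3P[ap p12 pb]; by rewrite Rintegral_itvB//;
  exact: integrableS intg.
Qed.

(** The difference of [f] and the indefinite integral of [g] is absolutely
    continuous, and by Lebesgue's differentiation theorem its derivative is
    zero almost everywhere. *)
Lemma abs_continuous_FTC2 (R : realType) (a b : R) (f g : R -> R) :
  a <= b -> abs_continuous a b f -> mu.-integrable `[a, b] (EFin \o g) ->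
  {ae lebesgue_measure, forall t : R, a < t -> t < b ->
     derivable f t 1 /\ derive1 f t = g t} ->
  f b - f a = \int[mu]_(t in `[a, b]) g t.
Proof.
move=> ab acf intg df.
pose g0 := g \_ `[a, b].
have intg0 : mu.-integrable setT (EFin \o g0).
  by rewrite /g0 -restrict_EFin -integrable_mkcond.
have intgb : mu.-integrable `[a, b] (EFin \o g0) by exact: integrableS intg0.
pose F x := \int[mu]_(t in `[a, x]) g0 t.
have dfF (t : R) : (a < t -> t < b -> derivable f t 1 /\ derive1 f t = g t) ->
    lebesgue_pt g0 t -> a < t -> t < b -> is_derive t 1 (fun x => f x - F x) 0.
  move=> dft gt at_ tb; have [{}df dfE] := dft at_ tb.
  have [dF dFE] : derivable F t 1 /\ derive1 F t = g0 t.
    by apply: (FTC1_lebesgue_pt tb intgb) => //; rewrite bnd_simp ltW.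
  have -> : 0 = g t - g0 t.
    by rewrite /g0 patchE mem_set ?subrr//= in_itv/= !ltW.
  rewrite -dfE -dFE !derive1E.
  by apply: is_deriveB; apply/derivableP.
have H : {ae lebesgue_measure, forall t : R, a < t -> t < b ->
    is_derive t 1 (fun x => f x - F x) 0}.
  have lg := lebesgue_differentiation (integrable_locally (measurable_itv _)
    intg).
  by apply: (@filterS2 _ _ (ae_filter_ringOfSetsType _) _ _ _ _ df lg) => t;
    exact: dfF.
have := @abs_continuous_derive0 R a b (fun x => f x - F x) ab
  (abs_continuousB _ _ _ _ _ acf (abs_continuous_integral _ a b g0 intg0)) H.
have -> : F a = 0 by rewrite /F set_itv1 Rintegral_set1.
have -> : F b = \int[mu]_(t in `[a, b]) g t.
  by apply: eq_Rintegral => x xab; rewrite /g0 patchE xab.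
by rewrite subr0 => <-; rewrite opprB addrC subrK.
Qed.

(** * Change of variables by increasing C^1 bijections *)

(** [eq_measure_integral] compares integrals of two measures on sets where the
    measures agree; here they agree on subsets of [D], and the restricted
    measure is zero on subsets of the complement. *)
Lemma ge0_integral_mrestr d (X : measurableType d) (R : realType)
    (m : {measure set X -> \bar R}) (D : set X) (mD : measurable D)
    (f : X -> \bar R) :
  measurable_fun setT f -> (forall x, 0 <= f x)%E ->
  (\int[mrestr m mD]_x f x = \int[m]_(x in D) f x)%E.
Proof.
move=> mf f0; rewrite -(setvU D) ge0_integral_setU//=.
- rewrite [X in (X + _)%E](_ : _ = 0%E) ?add0e.
    by apply: eq_measure_integral => A mA AD; rewrite /= /mrestr setIidl.
  rewrite -(integral_measure_zero (~` D) f);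
    apply: eq_measure_integral => A mA AD.
  by rewrite /= /mrestr (_ : A `&` D = set0) ?measure0//;
    apply/disjoints_subset.
- exact: measurableC.
- by rewrite setvU.
- by apply/disj_setPS => x [].
Qed.

Lemma measurable_subgraph (R : realType) (w : R -> R) :
  measurable_fun setT w -> measurable [set p : R * R | 0 <= p.2 <= w p.1].
Proof.
move=> mw.
have -> : [set p : R * R | 0 <= p.2 <= w p.1] =
    (fun p : R * R => (0 <= p.2) && (p.2 <= w p.1)) @^-1` [set true].
  by apply/seteqP; split => p /=.
rewrite -[X in measurable X]setTI.
have : measurable_fun setT (fun p : R * R => (0 <= p.2) && (p.2 <= w p.1)).
  apply: measurable_and; apply: measurable_fun_ler => //.
  exact: measurableT_comp.
by apply.
Qed.

(** For an increasing bijection [F] of the line with continuous derivative [w],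
    the image of the measure with density [w] under [F] is the Lebesgue
    measure. The measure with density [w] is realized as the planar Lebesgue
    measure on the region [D] between the axis and the graph of [w], so that
    integrals against it are computed with Tonelli's theorem; its image gives
    each interval the right length by the fundamental theorem of calculus, and
    a measure with this property is the Lebesgue measure. *)
Section change_of_variables.
Context (R : realType) (F w Finv : R -> R).
Hypothesis dF : forall x : R, is_derive x 1 F (w x).
Hypothesis cw : continuous w.
Hypothesis w0 : forall x, 0 <= w x.
Hypothesis incF : {mono F : x y / x <= y}.
Hypothesis FK : cancel Finv F.

Let cF : continuous F.
Proof. by move=> x; case: (dF x) => h _;
  exact/differentiable_continuous/derivable1_diffP. Qed.

Let mF : measurable_fun setT F. Proof. exact: continuous_measurable_fun. Qed.
Let mw : measurable_fun setT w. Proof. exact: continuous_measurable_fun. Qed.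

Let D : set (R * R) := [set p : R * R | 0 <= p.2 <= w p.1].
Let mD : measurable D. Proof. exact: measurable_subgraph. Qed.

Let Q (p : R * R) := F p.1.
Let mQ : measurable_fun setT Q. Proof. exact: measurableT_comp. Qed.

Let integral_Q (f : R -> \bar R) :
  measurable_fun setT f -> (forall y, 0 <= f y)%E ->
  (\int[(mu \x mu)%E]_(p in D) f (Q p) = \int[mu]_x (f (F x) * (w x)%:E))%E.
Proof.
move=> mf f0; rewrite integral_mkcond fubini_tonelli1; last 2 first.
- by apply/(measurable_restrictT _ _).1 => //; apply: measurable_funTS;
    exact: measurableT_comp.
- by move=> p; rewrite erestrict_ge0.
apply: eq_integral => x _; rewrite /fubini_F.
transitivity (\int[mu]_(y in `[0%R, w x]) f (F x))%E.
  rewrite [RHS]integral_mkcond; apply: eq_integral => y _; rewrite !patchE.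
  by congr (if _ then _ else _); apply/idP/idP; rewrite !inE/= in_itv.
rewrite integral_cst//; congr (_ * _)%E;
  apply: etrans (lebesgue_measure_itv _) _.
rewrite /= lte_fin; case: ltP => [|wx0].
  by rewrite oppr0 adde0.
by rewrite (_ : w x = 0)//; apply/eqP; rewrite eq_le wx0 w0.
Qed.

Let pushforward_ocitv (X : set R) : ocitv X ->
  (mu X = pushforward (mrestr (mu \x mu)%E mD) Q X)%E.
Proof.
move=> [[a b] _ <-]/=.
have mX : measurable `]a, b]%classic by exact: measurable_itv.
transitivity (\int[(mu \x mu)%E]_(p in D) (\1_(Q @^-1` `]a,
  b]%classic) p)%:E)%E; last first.
  by rewrite integral_indic// -[X in measurable X]setTI; exact: mQ.
transitivity (\int[(mu \x mu)%E]_(p in D) (\1_(`]a, b]%classic) (Q p))%:E)%E;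
  last first.
  by apply: eq_integral => p _; rewrite !indicE; congr (_%:E); congr (_%:R);
    apply/idP/idP; rewrite !inE.
rewrite (integral_Q (EFin \o \1_(`]a, b]%classic)))//=; last first.
  by apply/measurable_EFinP; exact: measurable_indic.
have [ba|ab] := leP b a.
  rewrite set_itv_ge ?bnd_simp -?leNgt//;
    rewrite measure0 integral0_eq// => x _.
  by rewrite indic0 mul0e.
transitivity (\int[mu]_(x in `[Finv a, Finv b]) (w x)%:E)%E; last first.
  rewrite -integral_itv_obnd_cbnd; last exact/measurable_EFinP/measurable_funTS.
  rewrite integral_mkcond; apply: eq_integral => x _; rewrite patchE indicE.
  have -> : (x \in `]Finv a, Finv b]%classic) = (F x \in `]a, b]%classic).
    rewrite !mem_setE !in_itv/= -{2}(FK a) -{2}(FK b) (leW_mono incF).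
    by rewrite incF.
  by case: ifPn => _; rewrite ?mul1e ?mul0e.
have ab' : Finv a < Finv b by rewrite -(leW_mono incF) !FK.
rewrite (@continuous_FTC2 _ w F)//.
- by rewrite !FK lebesgue_measure_itv/= lte_fin ab.
- exact: continuous_subspaceT.
- split => [x _||]; first by case: (dF x).
  + by apply: cvg_at_right_filter; exact: cF.
  + by apply: cvg_at_left_filter; exact: cF.
- by move=> x _; rewrite derive1E; case: (dF x).
Qed.

Lemma ge0_integral_change_of_variables (f : R -> \bar R) :
  measurable_fun setT f -> (forall y, 0 <= f y)%E ->
  (\int[mu]_x (f (F x) * (w x)%:E) = \int[mu]_y f y)%E.
Proof.
move=> mf f0; rewrite -integral_Q// -ge0_integral_mrestr//;
  last exact: measurableT_comp.
have mQ' : measurable_fun (setT : set (measurableTypeR R * measurableTypeR R))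
    (Q : _ -> measurableTypeR R) by exact: mQ.
have h := ge0_integral_pushforward mQ' (mrestr (mu \x mu)%E mD) measurableT mf.
rewrite preimage_setT in h; rewrite -h; last by move=> y _.
apply: eq_measure_integral => A mA _; apply/esym/lebesgue_measure_unique => //.
Qed.

Lemma integrable_change_of_variables (f : R -> R) :
  mu.-integrable setT (EFin \o f) ->
  mu.-integrable setT (EFin \o (fun x => f (F x) * w x)).
Proof.
move=> /integrableP[/measurable_EFinP mf fy]; apply/integrableP; split.
  by apply/measurable_EFinP/measurable_funM => //; exact: measurableT_comp.
rewrite -ge0_integral_change_of_variables// in fy; last first.
  by apply: measurableT_comp => //; exact/measurable_EFinP.
apply: le_lt_trans fy; rewrite le_eqVlt; apply/orP; left; apply/eqP.
by apply: eq_integral => x _ /=; rewrite normrM EFinM (ger0_norm (w0 x)).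
Qed.

Lemma integral_change_of_variables (f : R -> R) : measurable_fun setT f ->
  \int[mu]_x (f (F x) * w x) = \int[mu]_y f y.
Proof.
move=> mf; have mf' : measurable_fun setT (EFin \o f) by exact/measurable_EFinP.
congr fine; rewrite [RHS]integralE [LHS]integralE; congr (_ - _)%E.
- rewrite -(ge0_integral_change_of_variables _ (measurable_funepos mf'))//.
  apply: eq_integral => x _ /=.
  by rewrite !funeposE/= -!EFin_max -EFinM maxr_pMl// mul0r.
- rewrite -(ge0_integral_change_of_variables _ (measurable_funeneg mf'))//.
  apply: eq_integral => x _ /=.
  by rewrite !funenegE/= -!EFin_max -EFinM maxr_pMl// mul0r mulNr.
Qed.

End change_of_variables.

(** * Fubini's theorem for product-dominated real functions *)

(** The bound by a product of integrable functions of one variable makes every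
    section integrable, not only almost every one, so the iterated integrals
    can be written with real-valued inner integrals. *)
Section dominated_fubini.
Context (R : realType) (K : R * R -> R) (f g : R -> R).
Hypothesis mK : measurable_fun setT K.
Hypothesis intf : mu.-integrable setT (EFin \o f).
Hypothesis intg : mu.-integrable setT (EFin \o g).
Hypothesis Kfg : forall x y, `|K (x, y)| <= f x * g y.

Let mK1 x : measurable_fun setT (fun y => K (x, y)).
Proof. exact: measurableT_comp. Qed.

Let mK2 y : measurable_fun setT (fun x => K (x, y)).
Proof. exact: measurableT_comp. Qed.

Lemma dominated_section1 x : mu.-integrable setT (EFin \o (fun y => K (x, y))).
Proof.
apply: (@le_integrable _ _ _ mu setT measurableT _ (fun y =>
  (f x)%:E * (g y)%:E)%E).
- by apply/measurable_EFinP; exact: mK1.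
- by move=> y _ /=; rewrite lee_fin (le_trans (Kfg x y))// ler_norm.
- exact: integrableZl.
Qed.

Lemma dominated_section2 y : mu.-integrable setT (EFin \o (fun x => K (x, y))).
Proof.
apply: (@le_integrable _ _ _ mu setT measurableT _ (fun x =>
  (g y)%:E * (f x)%:E)%E).
- by apply/measurable_EFinP; exact: mK2.
- by move=> x _ /=; rewrite lee_fin (le_trans (Kfg x y))// mulrC ler_norm.
- exact: integrableZl.
Qed.

Lemma dominated_prod : (mu \x mu)%E.-integrable setT (EFin \o K).
Proof.
apply/integrable12ltyP; first by apply/measurable_EFinP; exact: mK.
have intfg : mu.-integrable setT (fun x => (f x)%:E * \int[mu]_y (g y)%:E)%E.
  rewrite -(fineK (integrable_fin_num measurableT intg)).
  exact: (integrableZr measurableT (fine (\int[mu]_y (g y)%:E)) intf).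
apply: le_lt_trans (integrable_lty measurableT intfg).
apply: ge0_le_integral => //.
- by move=> x _; exact: integral_ge0.
- have mabs : measurable_fun setT (abse \o (EFin \o K)).
    by apply: measurableT_comp => //; apply/measurable_EFinP; exact: mK.
  exact: (@measurable_fun_fubini_tonelli_F _ _ _ _ _ mu _ mabs (fun=> abse_ge0
    _)).
- exact: measurable_int intfg.
- move=> x _; rewrite -integralZl//; apply: ge0_le_integral => //.
  + by apply: measurableT_comp => //; apply/measurable_EFinP; exact: mK1.
  + exact: measurable_int (integrableZl measurableT (f x) intg).
  + by move=> y _ /=; rewrite -EFinM lee_fin.
Qed.

Lemma dominated_Rintegral1 :
  mu.-integrable setT (EFin \o (fun x => \int[mu]_y K (x, y))).
Proof.
have := integrable_fubini_F dominated_prod; apply: eq_integrable => // x _ /=.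
by rewrite /Rintegral fineK//; apply: integrable_fin_num => //;
  exact: dominated_section1.
Qed.

Lemma dominated_prod12 :
  \int[(mu \x mu)%E]_p K p = \int[mu]_x \int[mu]_y K (x, y).
Proof.
rewrite /Rintegral -(integral12_prod_meas1 dominated_prod).
congr fine; apply: eq_integral => x _.
by rewrite fineK//; apply: integrable_fin_num => //; exact: dominated_section1.
Qed.

Lemma dominated_prod21 :
  \int[(mu \x mu)%E]_p K p = \int[mu]_y \int[mu]_x K (x, y).
Proof.
rewrite /Rintegral -(integral21_prod_meas1 dominated_prod).
congr fine; apply: eq_integral => y _.
by rewrite fineK//; apply: integrable_fin_num => //; exact: dominated_section2.
Qed.

End dominated_fubini.

(** * Reflections, scalings and the signed square *)

Lemma ge0_integral_opp (R : realType) (f : R -> \bar R) :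
  measurable_fun setT f -> (forall y, 0 <= f y)%E ->
  (\int[mu]_x f (- x)%R = \int[mu]_y f y)%E.
Proof.
move=> mf f0.
have mN : measurable_fun (setT : set (measurableTypeR R))
  (-%R : measurableTypeR R -> measurableTypeR R) by exact: oppr_measurable.
have := ge0_integral_pushforward mN mu measurableT mf.
rewrite preimage_setT => <-//; apply: eq_measure_integral => //= A mA _.
exact: lebesgue_measureN.
Qed.

Lemma integral_opp (R : realType) (f : R -> R) : measurable_fun setT f ->
  \int[mu]_x f (- x) = \int[mu]_y f y.
Proof.
move=> mf; have mf' : measurable_fun setT (EFin \o f) by exact/measurable_EFinP.
congr fine; rewrite [RHS]integralE [LHS]integralE; congr (_ - _)%E.
- rewrite -(ge0_integral_opp _ _ (measurable_funepos mf'))//.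
  by apply: eq_integral => x _ /=; rewrite !funeposE.
- rewrite -(ge0_integral_opp _ _ (measurable_funeneg mf'))//.
  by apply: eq_integral => x _ /=; rewrite !funenegE.
Qed.

Lemma integrable_opp (R : realType) (f : R -> R) :
  mu.-integrable setT (EFin \o f) ->
  mu.-integrable setT (EFin \o (fun x => f (- x))).
Proof.
move=> /integrableP[/measurable_EFinP mf fy]; apply/integrableP; split.
  by apply/measurable_EFinP; apply: measurableT_comp => //;
    exact: oppr_measurable.
rewrite -ge0_integral_opp// in fy.
by apply: measurableT_comp => //; exact/measurable_EFinP.
Qed.

(** A way to compute derivatives by a single algebraic estimate; it applies to
    the map sending [y] to [y * `|y|], whose derivative is Lipschitz but not
    differentiable. *)
Lemma is_derive_quadratic (R : realType) (F : R -> R) (C d x : R) :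
  (forall h, `|F (x + h) - F x - d * h| <= C * h ^+ 2) -> is_derive x 1 F d.
Proof.
move=> Fd.
have H : h^-1 *: (F (h *: 1 + x) - F x) @[h --> (0:R)^'] --> d.
  apply/cvgrPdist_le => e e0; rewrite near_withinE; apply/nbhs_ballP.
  have C0 : 0 < `|C| + 1 by rewrite ltr_wpDl.
  exists (e / (`|C| + 1)) => /=; first by rewrite divr_gt0.
  move=> h; rewrite /ball/= sub0r normrN ltr_pdivlMr// => he h0.
  rewrite [_ *: _](_ : _ = h^-1 * (F (h *: 1 + x) - F x))//.
  rewrite [h%:A]mulr1 (addrC h) distrC.
  rewrite (_ : _ - d = h^-1 * (F (x + h) - F x - d * h)); last first.
    by field.
  rewrite normrM normfV ler_pdivrMl ?normr_gt0// (le_trans (Fd h))//.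
  have := ler_norm C; have := normr_ge0 h; rewrite -real_normK ?num_real//; nra.
apply: DeriveDef; first by apply/cvg_ex; exists d.
exact: (cvg_lim _ H).
Qed.

Lemma is_derive_mul_norm (R : realType) (x : R) :
  is_derive x 1 (fun y : R => y * `|y|) (2 * `|x|).
Proof.
apply: (is_derive_quadratic _ _ 1) => h; rewrite mul1r ler_norml.
have [[h1 h2] h3] := (sqr_ge0 h, sqr_ge0 (x + h), sqr_ge0 x).
case: (ger0P x) => x0; case: (ger0P (x + h)) => xh0; apply/andP; split;
  rewrite !expr2 in h1 h2 h3 *; nra.
Qed.

Section scaling.
Context (R : realType) (k : R) (k0 : 0 < k).

Let dF (x : R) : is_derive x 1 (fun y : R => k * y) k.
Proof. by apply: (is_derive_quadratic _ _ 0) => h;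
  rewrite mul0r (_ : _ - _ - _ = 0) ?normr0//; ring. Qed.

Let incF : {mono (fun y : R => k * y) : x y / x <= y}.
Proof. by move=> x y; rewrite ler_pM2l. Qed.

Let FK : cancel (fun y : R => y / k) (fun y : R => k * y).
Proof. by move=> y; rewrite mulrC divfK// gt_eqF. Qed.

Let w0 (x : R) : 0 <= k. Proof. exact: ltW. Qed.

Lemma ge0_integral_scale (f : R -> \bar R) :
  measurable_fun setT f -> (forall y, 0 <= f y)%E ->
  (\int[mu]_x (f (k * x)%R * k%:E) = \int[mu]_y f y)%E.
Proof. by move=> mf f0; apply: ge0_integral_change_of_variables FK _ mf f0 =>
  // ?; exact: cvg_cst. Qed.

Lemma integral_scale (f : R -> R) : measurable_fun setT f ->
  \int[mu]_x (f (k * x) * k) = \int[mu]_y f y.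
Proof. by move=> mf; apply: integral_change_of_variables FK _ mf => // ?;
  exact: cvg_cst. Qed.

End scaling.

(** The signed square [a * (x * `|x|)] is a bijection of the line that agrees
    with [a * x ^+ 2] for nonnegative [x]; unlike the square it satisfies the
    hypotheses of the change of variables. *)
Section squaring.
Context (R : realType) (a : R) (a0 : 0 < a).

Let F (x : R) := a * (x * `|x|).
Let w (x : R) := a * (2 * `|x|).
Let Finv (y : R) := Num.sg y * Num.sqrt (`|y| / a).

Let dF (x : R) : is_derive x 1 F (w x).
Proof. by have := is_derive_mul_norm _ x => ?; apply: is_deriveZ. Qed.

Let cw : continuous w.
Proof. by move=> x; apply: cvgMr; apply: cvgMr; apply: cvg_norm. Qed.

Let w0 (x : R) : 0 <= w x. Proof. by rewrite !mulr_ge0// ltW. Qed.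

Let incF : {mono F : x y / x <= y}.
Proof.
apply: le_mono => x y xy; rewrite /F ltr_pM2l//.
case: (ger0P x) => x0; case: (ger0P y) => y0; nra.
Qed.

Let FK : cancel Finv F.
Proof.
move=> y; rewrite /F /Finv normrM normr_sg.
have [->|y0] := eqVneq y 0; first by rewrite sgr0 !mul0r mulr0.
rewrite mul1r (ger0_norm (sqrtr_ge0 _)) -mulrA -expr2 sqr_sqrtr; last first.
  by rewrite divr_ge0// ltW.
by rewrite mulrCA [a * _]mulrC divfK ?gt_eqF// -numEsg.
Qed.

Lemma integral_square (f : R -> R) : measurable_fun setT f ->
  \int[mu]_x (f (a * (x * `|x|)) * (a * (2 * `|x|))) = \int[mu]_y f y.
Proof. exact: (integral_change_of_variables _ F w Finv). Qed.

Lemma integrable_square (f : R -> R) : mu.-integrable setT (EFin \o f) ->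
  mu.-integrable setT (EFin \o (fun x =>
    f (a * (x * `|x|)) * (a * (2 * `|x|)))).
Proof. exact: (integrable_change_of_variables _ F w Finv). Qed.

End squaring.

(** * Integration by parts against a primitive *)

Lemma continuous_derive_FTC2 (R : realType) (F f : R -> R) (a b : R) :
  a <= b -> (forall x : R, is_derive x 1 F (f x)) -> continuous f ->
  \int[mu]_(x in `[a, b]) f x = F b - F a.
Proof.
rewrite le_eqVlt => /predU1P[<-|ab] dF cf.
  by rewrite set_itv1 Rintegral_set1 subrr.
have cF : continuous F.
  by move=> x; case: (dF x) => h _;
    exact/differentiable_continuous/derivable1_diffP.
rewrite /Rintegral (@continuous_FTC2 _ f F)//.
- exact: continuous_subspaceT.
- split => [x _||]; first by case: (dF x).
  + by apply: cvg_at_right_filter; exact: cF.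
  + by apply: cvg_at_left_filter; exact: cF.
- by move=> x _; rewrite derive1E; case: (dF x).
Qed.

Lemma continuous_integrable_itv (R : realType) (f : R -> R) (a b : R) :
  continuous f -> mu.-integrable `[a, b] (EFin \o f).
Proof.
move=> cf; apply: continuous_compact_integrable; first exact: segment_compact.
exact: continuous_subspaceT.
Qed.

Lemma integrable_itvM_continuous (R : realType) (f h : R -> R) (a b : R) :
  mu.-integrable `[a, b] (EFin \o f) -> continuous h ->
  mu.-integrable `[a, b] (EFin \o (fun x => f x * h x)).
Proof.
move=> intf ch; apply: (integrableMl _ intf) => //.
  by apply: measurable_funTS; exact: continuous_measurable_fun.
have ch' : {within `[a, b], continuous h} by exact: continuous_subspaceT.
have /compact_bounded[M [_ mrt]] := continuous_compact ch' (@segment_compact _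
  a b).
by exists M; split; rewrite ?num_real // => ? ? ? ?; exact: mrt.
Qed.

Lemma integrable_patch (R : realType) (f : R -> R) (D : set R) : measurable D ->
  mu.-integrable D (EFin \o f) -> mu.-integrable setT (EFin \o (f \_ D)).
Proof. by move=> mD; rewrite -restrict_EFin -integrable_mkcond. Qed.

(** Insert the primitive of [G] for [H - H a] and exchange the order of
    integration over the triangle [a <= u <= x <= b]: the inner integral of
    [dchi] over [u <= x <= b] is [- chi u]. The constant [H a] contributes
    nothing since [chi] vanishes at both ends. *)
Lemma integral_by_parts_primitive (R : realType) (a b : R)
    (H G chi dchi : R -> R) :
  a <= b -> mu.-integrable `[a, b] (EFin \o G) ->
  (forall x, a <= x -> x <= b -> H x - H a = \int[mu]_(u in `[a, x]) G u) ->
  (forall x : R, is_derive x 1 chi (dchi x)) -> continuous dchi ->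
  chi a = 0 -> chi b = 0 ->
  \int[mu]_(x in `[a, b]) (H x * dchi x) =
    - \int[mu]_(x in `[a, b]) (G x * chi x).
Proof.
move=> ab intG HG dchiE cdchi chia chib.
pose G0 := G \_ `[a, b]; pose d0 := dchi \_ `[a, b].
have intG0 : mu.-integrable setT (EFin \o G0) by exact: integrable_patch.
have intd0 : mu.-integrable setT (EFin \o d0).
  by apply: integrable_patch => //; exact: continuous_integrable_itv.
have mG0 : measurable_fun setT G0 by case/integrableP : intG0 =>
  /measurable_EFinP.
have md0 : measurable_fun setT d0 by case/integrableP : intd0 =>
  /measurable_EFinP.
pose E : set (R * R) := [set p | p.2 <= p.1].
have mE : measurable E.
  have : measurable_fun setT (fun p : R * R =>
    p.2 <= p.1) by exact: measurable_fun_ler.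
  by move=> /(_ measurableT [set true] ltac:(by [])); rewrite setTI;
    congr measurable.
pose K (p : R * R) := d0 p.1 * G0 p.2 * \1_E p.
have mK : measurable_fun setT K.
  by apply: measurable_funM; [apply: measurable_funM;
    exact: measurableT_comp|exact: measurable_indic].
have Kle x y : `|K (x, y)| <= `|d0 x| * `|G0 y|.
  rewrite /K/= normrM normrM ler_piMr ?mulr_ge0//.
  by rewrite indicE; case: (_ \in _); rewrite ?normr1 ?normr0.
have EE x u : ((x, u) \in E) = (u <= x) by apply/idP/idP; rewrite !inE.
have ind0 := integrable_norm intd0; have inG0 := integrable_norm intG0.
have := dominated_prod12 _ _ _ _ mK ind0 inG0 Kle.
have intK1 := dominated_Rintegral1 _ _ _ _ mK ind0 inG0 Kle.
rewrite (dominated_prod21 _ _ _ _ mK ind0 inG0 Kle).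
have K1 x : \int[mu]_y K (x, y) = ((fun x =>
  H x * dchi x - H a * dchi x) \_ `[a, b]) x.
  rewrite /K/= patchE; case: ifPn => [|xab]; last first.
    rewrite [d0 x](_ : _ = 0).
      by under eq_Rintegral do rewrite !mul0r; rewrite Rintegral_cst// mul0r.
    by rewrite /d0 patchE (negbTE xab).
  rewrite inE/= in_itv/= => /andP[ax xb].
  rewrite -mulrBl HG// mulrC Rintegral_mkcond -RintegralZl//; last first.
    by apply: integrable_patch => //; apply: integrableS intG => //;
      exact: subset_itvl.
  apply: eq_Rintegral => u _; rewrite -mulrA; congr (_ * _).
    by rewrite /d0 patchE mem_set//= in_itv/= ax xb.
  rewrite /G0 !patchE indicE EE !mem_setE !in_itv/=.
  case: (lerP u x) => ux; rewrite ?mulr0 ?andbF// mulr1 andbT.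
  by rewrite (le_trans ux xb) andbT.
have K2 y : \int[mu]_x K (x, y) = - ((fun x => G x * chi x) \_ `[a, b]) y.
  rewrite /K/= patchE; case: ifPn => [|yab]; last first.
    rewrite [G0 y](_ : _ = 0).
      by under eq_Rintegral do rewrite mulr0 mul0r;
        rewrite Rintegral_cst// mul0r oppr0.
    by rewrite /G0 patchE (negbTE yab).
  rewrite inE/= in_itv/= => /andP[ay yb].
  rewrite -mulrN -[- chi y]add0r -chib -(continuous_derive_FTC2 _ _ _ _ _ yb
    dchiE cdchi).
  rewrite Rintegral_mkcond -RintegralZl//; last first.
    by apply: integrable_patch => //; exact: continuous_integrable_itv.
  apply: eq_Rintegral => u _.
  rewrite /d0 /G0 !patchE indicE EE !mem_setE !in_itv/= ay yb/= [RHS]mulrC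
    -mulrA [G y * _]mulrC mulrA.
  congr (_ * _); case: (lerP y u) => yu; rewrite ?mulr0// mulr1.
  by rewrite (le_trans ay yu).
under eq_Rintegral do rewrite K2.
under [RHS]eq_Rintegral do rewrite K1.
rewrite -Rintegral_mkcond.
have intHd : mu.-integrable `[a, b] (EFin \o (fun x =>
  H x * dchi x - H a * dchi x)).
  rewrite integrable_mkcond// restrict_EFin;
    apply: eq_integrable intK1 => // x _ /=.
  by rewrite K1.
have intHad : mu.-integrable `[a, b] (EFin \o (fun x => H a * dchi x)).
  exact: (integrableZl _ _ (continuous_integrable_itv _ _ a b cdchi)).
have -> : \int[mu]_(x in `[a, b]) (H x * dchi x - H a * dchi x) =
    \int[mu]_(x in `[a, b]) (H x * dchi x).
  rewrite -[RHS]subr0 -[in RHS](_ : \int[mu]_(x in `[a, b]) (H a * dchi x) = 0).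
    rewrite -RintegralB//.
    have mI : measurable (`[a, b]%classic : set (measurableTypeR R)) by exact:
      measurable_itv.
    have := integrableD mI intHd intHad.
    by apply: eq_integrable => // x _ /=; rewrite -EFinD subrK.
  rewrite RintegralZl//; last exact: continuous_integrable_itv.
  by rewrite (continuous_derive_FTC2 _ chi)// chia chib subrr mulr0.
move=> <-; rewrite [X in - X]Rintegral_mkcond -mulN1r -RintegralZl//;
  last first.
  apply: integrable_patch => //; apply: integrable_itvM_continuous => //.
  by move=> x; case: (dchiE x) => h _;
    exact/differentiable_continuous/derivable1_diffP.
by apply: eq_Rintegral => x _; rewrite mulN1r.
Qed.

(** * Composition of a primitive with the square *)

(** If [rho] is a primitive of [g] on the half-line, then [rho (a * x ^+ 2)] is
    a primitive of [G] on the whole line, as the chain rule predicts, although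
    [g] is only locally integrable. On the positive half-line this is the
    change of variables by the signed square; evenness of the composition and
    oddness of [G] give the negative half-line. *)
Section square_composition.
Context (R : realType) (a : R) (rho g : R -> R) (a0 : 0 < a).
Hypothesis mg : measurable_fun setT g.
Hypothesis intg : forall B, mu.-integrable `[0, B] (EFin \o g).
Hypothesis rhoE : forall u v, 0 <= u -> u <= v ->
  rho v - rho u = \int[mu]_(t in `[u, v]) g t.

Let G (x : R) := 2 * a * x * g (a * x ^+ 2).

Let patchG (x y : R) : 0 <= x -> x <= y ->
  (fun z => (g \_ `[(a * x ^+ 2), (a * y ^+ 2)]) (a * (z * `|z|)) * (a * (2 *
    `|z|))) =
  G \_ `[x, y].
Proof.
move=> x0 xy; apply/funext => z; rewrite !patchE !mem_setE !in_itv/=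
  !ler_pM2l//.
have [z0|z0] := ger0P z.
  rewrite -!expr2 !ler_sqr ?nnegrE ?(le_trans x0 xy)//.
  by case: ifP => _; rewrite ?mul0r// /G; ring.
have -> : (x <= z) = false by apply/negbTE; rewrite -ltNge; lra.
rewrite (_ : (x ^+ 2 <= z * - z) = false) ?mul0r//.
by apply/negbTE; rewrite -ltNge expr2; nra.
Qed.

Let mG : measurable_fun setT G.
Proof.
apply: measurable_funM; first exact: mulrl_measurable.
apply: measurableT_comp => //; apply: measurable_funM => //.
Qed.

Let mpatch (D : set R) (f : R -> R) : measurable D -> measurable_fun setT f ->
  measurable_fun setT (f \_ D).
Proof. by move=> mD mf; apply/(measurable_restrictT _ _).1 => //;
  exact: measurable_funS mf. Qed.

Let integrable_G0 (y : R) : 0 <= y ->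
  mu.-integrable setT (EFin \o (G \_ `[0, y])).
Proof.
move=> y0; rewrite -patchG//; apply: integrable_square => //.
by rewrite expr0n mulr0; apply: integrable_patch.
Qed.

Let GN x : G (- x) = - G x. Proof. by rewrite /G sqrrN; ring. Qed.

Lemma integrable_square_deriv (M : R) : 0 <= M ->
  mu.-integrable `[(- M), M] (EFin \o G).
Proof.
move=> M0; rewrite integrable_mkcond// restrict_EFin.
have h1 := integrable_G0 _ M0; have h2 := integrable_opp _ _ h1.
have := integrableB measurableT h1 h2; apply: eq_integrable => // x _ /=.
rewrite -EFinB !patchE !mem_setE !in_itv/= GN oppr_ge0 -[point]/(0 : R).
congr (_%:E); have [x0|x0|->] := ltgtP x 0.
- rewrite (le_trans (ltW x0) M0) andbT (lerNl x) lerNl.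
  by rewrite /= ?andbT; case: ifP => _; rewrite ?opprK ?oppr0 add0r.
- by rewrite /= subr0 (_ : (- M <= x)); last by lra.
- by rewrite oppr0 M0 oppr_le0 M0 /= opprK /G mulr0 mul0r addr0.
Qed.

Let square_FTC (x y : R) : 0 <= x -> x <= y ->
  rho (a * y ^+ 2) - rho (a * x ^+ 2) = \int[mu]_(z in `[x, y]) G z.
Proof.
move=> x0 xy; rewrite rhoE.
- rewrite [LHS]Rintegral_mkcond [RHS]Rintegral_mkcond -patchG//.
  by rewrite (integral_square _ _ a0)//; exact: mpatch.
- by rewrite mulr_ge0 ?sqr_ge0// ltW.
- by rewrite ler_pM2l// ler_sqr ?nnegrE// (le_trans x0).
Qed.

Let square_FTC_sym (M x : R) : 0 <= M -> - M <= x -> x <= M ->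
  rho (a * x ^+ 2) - rho (a * (- M) ^+ 2) = \int[mu]_(z in `[(- M), x]) G z.
Proof.
move=> M0 Mx xM.
have neg y : - M <= y -> y <= 0 ->
    rho (a * y ^+ 2) - rho (a * (- M) ^+ 2) = \int[mu]_(z in `[(- M), y]) G z.
  move=> My y0; rewrite [(- M) ^+ 2]sqrrN -(sqrrN y) -opprB square_FTC;
    [|lra|lra].
  rewrite [X in - X]Rintegral_mkcond [RHS]Rintegral_mkcond -(integral_opp _ (G
    \_ `[(- M), y])); last exact: mpatch.
  rewrite -[LHS]mulN1r -RintegralZl//; last first.
    apply: integrable_patch => //; apply: integrableS (integrable_square_deriv
      _ M0) => //.
    by apply: subset_itvr; rewrite bnd_simp; lra.
  apply: eq_Rintegral => z _; rewrite !patchE !mem_setE !in_itv/=.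
  rewrite lerN2 (lerNl z) andbC mulN1r; case: ifP => _; rewrite ?oppr0//.
have [x0|x0] := leP x 0; first exact: neg.
rewrite (_ : _ - _ = (rho (a * x ^+ 2) - rho (a * 0 ^+ 2)) +
  (rho (a * 0 ^+ 2) - rho (a * (- M) ^+ 2))); last by ring.
rewrite square_FTC ?(ltW x0)// neg// ?oppr_le0//.
rewrite -(Rintegral_itv_obnd_cbnd); last first.
  by apply: integrableS (integrable_square_deriv _ M0) => // z /=;
    rewrite !in_itv/= => /andP[? ?]; apply/andP; split; lra.
rewrite -(@Rintegral_itvB _ _ (BLeft (- M)) (BRight x) 0)//.
- by rewrite subrK.
- apply: integrableS (integrable_square_deriv _ M0) => //.
  by apply: subset_itvl; rewrite bnd_simp.
- by rewrite bnd_simp oppr_le0.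
- by rewrite bnd_simp ltW.
Qed.

Lemma integral_square_by_parts (M : R) (chi dchi : R -> R) : 0 <= M ->
  (forall x : R, is_derive x 1 chi (dchi x)) -> continuous dchi ->
  (forall x, M <= `|x| -> chi x = 0) ->
  \int[mu]_(x in `[(- M), M]) (rho (a * x ^+ 2) * dchi x) =
    - \int[mu]_(x in `[(- M), M]) (2 * a * x * g (a * x ^+ 2) * chi x).
Proof.
move=> M0 dchiE cdchi chi0.
apply: (integral_by_parts_primitive _ (- M) M (fun x => rho (a * x ^+ 2)) G) =>
  //.
- lra.
- exact: integrable_square_deriv.
- by move=> x Mx xM; exact: square_FTC_sym.
- by apply: chi0; rewrite normrN ler_norm.
- by apply: chi0; rewrite ler_norm.
Qed.

End square_composition.

(** * Relaxation functions *)

Lemma integrable_compact_support (R : realType) (f h : R -> R) (M : R) :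
  locally_integrable setT f -> continuous h ->
  (forall x, M <= `|x| -> h x = 0) ->
  mu.-integrable setT (EFin \o (fun x => f x * h x)) /\
  \int[mu]_x (f x * h x) = \int[mu]_(x in `[(- M), M]) (f x * h x).
Proof.
move=> [mf _ lf] ch h0.
have intf : mu.-integrable `[(- M), M] (EFin \o f).
  apply/integrableP; split; first by apply/measurable_EFinP;
    exact: measurable_funS mf.
  exact: (lf `[(- M), M]%classic (@subsetT _ _) (@segment_compact _ _ _)).
have intfh := integrable_itvM_continuous _ _ _ _ _ intf ch.
have E : (fun x => f x * h x) = (fun x => f x * h x) \_ `[(- M), M].
  apply/funext => x; rewrite patchE mem_setE in_itv/= -ler_norml.
  by case: ifPn => //; rewrite -ltNge => /ltW /h0 ->; rewrite mulr0.
split; first by rewrite E; exact: integrable_patch.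
by rewrite {1}E -Rintegral_mkcond.
Qed.

Section relaxation.
Context (R : realType) (T tau0 : R) (ell rho : R -> R).
Hypothesis T_gt0 : 0 < T.
Hypothesis tau0_gt0 : 0 < tau0.
Hypothesis ell_control : control_term T tau0 ell.
Hypothesis rho_relaxation : relaxation_function T tau0 ell rho.

Lemma relaxation_supp u : u < 0 \/ T < u -> rho u = 0.
Proof.
case: rho_relaxation => supp _ _ _ u0T; apply/eqP; apply: contrapT => /negP h.
have : closure [set t | rho t != 0] u by apply: subset_closure.
rewrite supp /= in_itv/= => /andP[? ?]; case: u0T; lra.
Qed.

(** Composing with the retraction onto [0, T] removes the jump of [rho]
    at [0] and gives a function that is continuous on the whole line. *)
Let clamp (x : R) := if x <= 0 then 0 else if x <= T then x else T.

Let clampP x : 0 <= clamp x <= T.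
Proof.
have := T_gt0; rewrite /clamp.
by case: (leP x 0) => ?; case: (leP x T) => ? ?; apply/andP; split; lra.
Qed.

Let clamp_id x : 0 <= x <= T -> clamp x = x.
Proof.
by move=> /andP[? ?]; rewrite /clamp; case: (leP x 0) => ?;
  case: (leP x T) => ?; lra.
Qed.

Let clamp_lip x y : x <= y -> clamp x <= clamp y /\ clamp y - clamp x <= y - x.
Proof.
have := T_gt0; move=> T0 xy; rewrite /clamp; case: (leP x 0) => ?;
  case: (leP x T) => ?;
  case: (leP y 0) => ?; case: (leP y T) => ?; split; lra.
Qed.

Let rho_clamp_continuous : continuous (rho \o clamp).
Proof.
case: rho_relaxation => _ _ /(_ T T_gt0) ac _ x.
apply/cvgrPdist_lt => e e0; have [d d0 H] := ac e e0.
apply/nbhs_ballP; exists d => //= y; rewrite /ball/= => xyd.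
have {}H u v : u <= v -> `|u - v| < d -> `|rho (clamp v) - rho (clamp u)| < e.
  move=> uv uvd; have [c1 c2] := clamp_lip _ _ uv.
  have /andP[u0 uT] := clampP u; have /andP[v0 vT] := clampP v.
  have := H [:: (clamp u, clamp v)]; rewrite !big_seq1/= u0 c1 vT; apply => //.
  by apply: le_lt_trans uvd; rewrite distrC ger0_norm ?subr_ge0.
by have [xy|/ltW xy] := leP x y; [rewrite distrC; exact: H|apply: H => //;
  rewrite distrC].
Qed.

Let rhoE : rho = (rho \o clamp) \_ `[0, T].
Proof.
apply/funext => x; rewrite patchE mem_setE in_itv/=; case: ifPn => [xT|].
  by rewrite /= clamp_id.
rewrite negb_and -!ltNge => /orP h; apply: relaxation_supp.
by case: h; [left|right].
Qed.

Lemma relaxation_measurable : measurable_fun setT rho.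
Proof.
rewrite rhoE; apply/(measurable_restrictT _ _).1 => //.
by apply: measurable_funTS; exact: continuous_measurable_fun.
Qed.

Lemma relaxation_bounded : exists C, forall u, `|rho u| <= C.
Proof.
have ch' : {within `[0, T], continuous (rho \o clamp)} by exact:
  continuous_subspaceT.
have /compact_bounded[M [_ mrt]] := continuous_compact ch' (@segment_compact _
  0 T).
exists (`|M| + 1) => u; rewrite rhoE patchE; case: ifPn => uT;
  last by rewrite normr0.
apply: mrt; last by exists u => //; exact: set_mem.
by rewrite ltr_pwDr// ler_norm.
Qed.

(** The right-hand side of the relaxation equation solved for the derivative
    of [rho]. *)
Definition relaxation_rate (u : R) := - ell u - tau0^-1 * rho u.

Lemma control_measurable : measurable_fun setT ell.
Proof. by case: ell_control => -[]. Qed.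

Lemma relaxation_rate_measurable : measurable_fun setT relaxation_rate.
Proof.
apply: measurable_funB.
  by apply: measurable_funN; exact: control_measurable.
by apply: measurable_funM => //; exact: relaxation_measurable.
Qed.

Lemma control_integrable a b : mu.-integrable `[a, b] (EFin \o ell).
Proof.
case: ell_control => -[mf _ lf] _ _ _; apply/integrableP; split.
  by apply/measurable_EFinP; exact: measurable_funS mf.
exact: (lf `[a, b]%classic (@subsetT _ _) (@segment_compact _ _ _)).
Qed.

Lemma relaxation_integrable a b : mu.-integrable `[a, b] (EFin \o rho).
Proof.
have [C rhoC] := relaxation_bounded.
apply: measurable_bounded_integrable => //.
- have muI : mu `[a, b] = (if a < b then b - a else 0)%:E.
    by rewrite lebesgue_measure_itv/= lte_fin; case: ifP.
  by have := ltry (if a < b then b - a else 0); rewrite -muI.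
- by apply: measurable_funS relaxation_measurable.
- by exists C; split; rewrite ?num_real // => x Cx u _ /=;
    rewrite (le_trans (rhoC u))// ltW.
Qed.

Lemma relaxation_rate_integrable a b :
  mu.-integrable `[a, b] (EFin \o relaxation_rate).
Proof.
have mI : measurable (`[a, b]%classic : set (measurableTypeR R)) by exact:
  measurable_itv.
have := integrableB mI (integrableN (control_integrable a b))
  (integrableZl mI tau0^-1 (relaxation_integrable a b)).
by apply: eq_integrable => // x _ /=.
Qed.

Lemma relaxation_FTC u v : 0 <= u -> u <= v ->
  rho v - rho u = \int[mu]_(t in `[u, v]) relaxation_rate t.
Proof.
move=> u0 uv; case: rho_relaxation => _ _ ac de.
apply: abs_continuous_FTC2 => //.
- have v1 : 0 < v + 1 by lra.
  move=> e /(ac _ v1)[d d0 H]; exists d => // s sab; apply: H.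
  by apply: sub_all sab => p /and3P[? -> ?] /=; apply/andP; split; lra.
- exact: relaxation_rate_integrable.
- apply: (@filterS _ _ (ae_filter_ringOfSetsType _) _ _ _ de).
  move=> t dt ut tv; have [dr H] := dt (le_lt_trans u0 ut).
  split => //; rewrite /relaxation_rate.
  have t0 : tau0 != 0 by rewrite gt_eqF.
  apply: (mulfI t0); rewrite mulrBr mulVKf// mulrN -mulNr -H; ring.
Qed.

End relaxation.

(** * The relaxation function and the control term composed with a square *)

Section relaxation_square.
Context (R : realType) (T tau0 : R) (ell rho : R -> R) (a : R).
Hypothesis T_gt0 : 0 < T.
Hypothesis tau0_gt0 : 0 < tau0.
Hypothesis ell_control : control_term T tau0 ell.
Hypothesis rho_relaxation : relaxation_function T tau0 ell rho.
Hypothesis a_gt0 : 0 < a.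

Let measurable_square (f : R -> R) : measurable_fun setT f ->
  measurable_fun setT (fun x : R => f (a * x ^+ 2)).
Proof. by move=> mf; apply: measurableT_comp => //; exact: measurable_funM. Qed.

Let locally_integrable_itv (f : R -> R) : measurable_fun setT f ->
  (forall M, 0 <= M -> mu.-integrable `[(- M), M] (EFin \o f)) ->
  locally_integrable setT f.
Proof.
move=> mf intf; split => // [|K _ cK]; first exact: openT.
have /compact_bounded[M [_ KM]] := cK.
have KI : K `<=` `[(- (`|M| + 1)), (`|M| + 1)].
  by move=> x Kx /=; rewrite in_itv/= -ler_norml; apply: KM => //;
    rewrite ltr_pwDr// ler_norm.
have M0 : 0 <= `|M| + 1 by rewrite addr_ge0.
have /integrableP[mf' +] := intf _ M0; apply: le_lt_trans.
apply: ge0_subset_integral => //; first exact: compact_measurable.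
by apply/measurable_EFinP; apply: measurableT_comp => //;
  exact: measurable_funS mf.
Qed.

Lemma relaxation_square_locally_integrable :
  locally_integrable setT (fun x : R => rho (a * x ^+ 2)).
Proof.
have [C rhoC] := relaxation_bounded _ _ _ _ _ T_gt0 rho_relaxation.
have mrho := relaxation_measurable _ _ _ _ _ T_gt0 rho_relaxation.
apply: locally_integrable_itv => [|M M0]; first exact: measurable_square.
apply: (@le_integrable _ _ _ mu _ _ _ (EFin \o cst C)) => //.
- by apply/measurable_EFinP; apply: measurable_funS (measurable_square _ mrho).
- by move=> x _ /=; rewrite lee_fin (le_trans (rhoC _))// ler_norm.
- by apply: continuous_integrable_itv => x; exact: cvg_cst.
Qed.

(** Substituting a square costs the factor [1 / `|x|], which is not integrable
    at the origin. Near [0] the function [ell] is bounded because it has a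
    limit from the right there; where [a * x ^+ 2 >= d], the integrable function
    [x * ell (a * x ^+ 2)], multiplied by [a * x / d], dominates. *)
Lemma control_square_locally_integrable :
  locally_integrable setT (fun x : R => ell (a * x ^+ 2)).
Proof.
have mell := control_measurable _ _ _ _ ell_control.
apply: locally_integrable_itv => [|M M0]; first exact: measurable_square.
have [_ _ + _] := ell_control.
move/cvgrPdist_le => /(_ 1 ltr01); rewrite near_withinE =>
  /nbhs_ballP[d /= d0 elld].
pose C := `|ell 0| + 1.
have ellC t : 0 <= t -> t < d -> `|ell t| <= C.
  rewrite le_eqVlt => /predU1P[<- _|t0 td]; first by rewrite /C; lra.
  have := elld t; rewrite /ball/= sub0r normrN gtr0_norm// => /(_ td t0) h.
  rewrite /C -(subrK (ell 0) (ell t)) addrC (le_trans (ler_normD _ _))// lerD2l.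
  by rewrite distrC.
have intq := integrable_square_deriv _ _ _ a_gt0 (fun B =>
  control_integrable _ _ _ _ ell_control 0 B) _ M0.
have ch : continuous (fun x : R => x / (2 * d)).
  by move=> x; apply: cvgMl; exact: cvg_id.
have int2 := integrable_norm (integrable_itvM_continuous _ _ _ _ _ intq ch).
have mI : measurable (`[(- M), M]%classic : set (measurableTypeR R)) by exact:
  measurable_itv.
have int3 : mu.-integrable `[(- M), M] (EFin \o cst C).
  by apply: continuous_integrable_itv => x; exact: cvg_cst.
apply: (@le_integrable _ _ _ mu _ _ _ _ _ _ (integrableD mI int3 int2)) => //.
- by apply/measurable_EFinP; apply: measurable_funS (measurable_square _ mell).
- move=> x _ /=; rewrite lee_fin; apply: le_trans (ler_norm _).
  have [xd|xd] := ltP (a * x ^+ 2) d.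
    by rewrite ler_wpDr// ellC// mulr_ge0 ?sqr_ge0// ltW.
  rewrite ler_wpDl ?addr_ge0//.
  rewrite (_ : 2 * a * x * ell (a * x ^+ 2) * (x / (2 * d)) =
    (a * x ^+ 2 / d) * ell (a * x ^+ 2)); last first.
    by field; rewrite gt_eqF.
  by rewrite normrM ler_peMl// (le_trans _ (ler_norm _))// ler_pdivlMr// mul1r.
Qed.

(** The weak form of the chain rule
    [(rho (a * x ^+ 2))' = - 2 * a * x * (ell + rho / tau0) (a * x ^+ 2)],
    solved for the term with [ell]. It eliminates [ell] from the attenuation
    term; the factor [x] is what makes this possible. *)
Lemma control_square_moment (M : R) (chi dchi : R -> R) : 0 <= M ->
  (forall x : R, is_derive x 1 chi (dchi x)) -> continuous dchi ->
  (forall x, M <= `|x| -> chi x = 0) -> (forall x, M <= `|x| -> dchi x = 0) ->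
  \int[mu]_x (ell (a * x ^+ 2) * (x * chi x)) =
    (2 * a)^-1 * \int[mu]_x (rho (a * x ^+ 2) * dchi x)
    - tau0^-1 * \int[mu]_x (rho (a * x ^+ 2) * (x * chi x)).
Proof.
move=> M0 dchiE cdchi chi0 dchi0.
have cchi : continuous chi.
  by move=> x; case: (dchiE x) => h _;
    exact/differentiable_continuous/derivable1_diffP.
have cxchi : continuous (fun x : R => x * chi x).
  by move=> x; apply: cvgM; [exact: cvg_id|exact: cchi].
have xchi0 x : M <= `|x| -> x * chi x = 0 by move=> /chi0 ->; rewrite mulr0.
have lrho := relaxation_square_locally_integrable.
have [i1 e1] := integrable_compact_support _ _ _ M
  control_square_locally_integrable cxchi xchi0.
have [i2 e2] := integrable_compact_support _ _ _ M lrho cxchi xchi0.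
have [_ ->] := integrable_compact_support _ _ _ M lrho cdchi dchi0.
have mrate := relaxation_rate_measurable _ _ _ _ _ T_gt0 ell_control
  rho_relaxation.
rewrite (integral_square_by_parts _ _ _ _ a_gt0 mrate
  (fun B => relaxation_rate_integrable _ _ _ _ _ T_gt0 ell_control
    rho_relaxation 0 B)
  (relaxation_FTC _ _ _ _ _ T_gt0 tau0_gt0 ell_control rho_relaxation) _ chi)//.
pose F1 x := ell (a * x ^+ 2) * (x * chi x).
pose F2 x := rho (a * x ^+ 2) * (x * chi x).
have mI : measurable (`[(- M), M]%classic : set (measurableTypeR R)) by exact:
  measurable_itv.
have j1 : mu.-integrable `[(- M), M] (EFin \o F1) by exact: integrableS i1.
have j2 : mu.-integrable `[(- M), M] (EFin \o F2) by exact: integrableS i2.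
rewrite e1 e2 -/(F1 _) -/(F2 _).
rewrite (_ : \int[mu]_(x in _) (_ * _ * relaxation_rate _ _ _ _ _ * _) =
  \int[mu]_(x in `[(- M), M]) (- (2 * a) * (F1 x + tau0^-1 * F2 x)));
    last first.
  by apply: eq_Rintegral => x _; rewrite /relaxation_rate /F1 /F2; ring.
have j3 : mu.-integrable `[(- M), M] (EFin \o (fun x => tau0^-1 * F2 x)).
  exact: (integrableZl mI tau0^-1 j2).
rewrite RintegralZl//; last first.
  by have := integrableD mI j1 j3; apply: eq_integrable.
rewrite RintegralD// RintegralZl//.
by field; rewrite !gt_eqF.
Qed.

End relaxation_square.

(** * Borel sets and continuous functions on the plane *)

Lemma open_measurable_prod (R : realType) (U : set (R * R)) :
  open U -> measurable U.
Proof.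
move=> oU.
have sym (q z d : R) : z - d < q -> q < z + d -> q - d < z < q + d.
  by move=> ? ?; apply/andP; split; lra.
have tri (q z u d e : R) : z - d < q -> q < z + d -> q - d < u -> u < q + d ->
    d < e / 2 -> `|z - u| < e.
  by move=> *; rewrite ltr_norml; apply/andP; split; lra.
pose I (q : rat) (n : nat) : set R := `](ratr q - n.+1%:R^-1),
  (ratr q + n.+1%:R^-1)[%classic.
pose B q1 q2 n : set (R * R) := if pselect (I q1 n `*` I q2 n `<=` U) then I q1
  n `*` I q2 n else set0.
have -> : U = \bigcup_(q1 in @setT rat) \bigcup_(q2 in @setT rat) \bigcup_n B
  q1 q2 n.
  apply/seteqP; split => [[x y] Uxy|[x y] [q1 _ [q2 _ [n _]]]]; last first.
    by rewrite /B; case: pselect => // h; exact: h.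
  have /nbhs_ballP[e /= e0 eU] : nbhs (x, y) U by exact: open_nbhs_nbhs.
  have e40 : 0 < e / 2 by rewrite divr_gt0.
  have [n _ ne] := near_infty_natSinv_lt (PosNum e40).
  have {}ne : n.+1%:R^-1 < e / 2 := ne _ (leqnn n).
  have n0 : 0 < n.+1%:R^-1 :> R by rewrite invr_gt0.
  have I0 z : z - n.+1%:R^-1 < z + n.+1%:R^-1 :> R by rewrite ltrBlDr -addrA
    ltrDl addr_gt0.
  have [q1] := rat_in_itvoo (I0 x).
  rewrite in_itv/= => /andP[q1l q1r].
  have [q2] := rat_in_itvoo (I0 y).
  rewrite in_itv/= => /andP[q2l q2r].
  exists q1 => //; exists q2 => //; exists n => //; rewrite /B;
    case: pselect => [h|]/=.
    by split; rewrite /I/= in_itv/=; exact: sym.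
  case=> -[u v] [].
  rewrite /I/= in_itv/= => /andP[u1 u2]; rewrite in_itv/= => /andP[v1 v2].
  by apply: eU; split; [exact: tri u1 u2 ne|exact: tri v1 v2 ne].
apply: bigcupT_measurable_rat => q1; apply: bigcupT_measurable_rat => q2.
apply: bigcup_measurable => n _; rewrite /B; case: pselect => [h|h]/=;
  last exact: measurable0.
by apply: measurableX; exact: measurable_itv.
Qed.

Lemma continuous_measurable_prod (R : realType) (f : R * R -> R) :
  continuous f -> measurable_fun setT f.
Proof.
move=> /continuousP cf; apply: (measurability _ (RGenOpens.measurableE R)).
move=> _ [_ [a [b ->] <-]]; rewrite setTI; apply: open_measurable_prod.
exact/cf/interval_open.
Qed.

Lemma compact_measurable_prod (R : realType) (K : set (R * R)) :
  compact K -> measurable K.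
Proof.
move=> cK; rewrite -(setCK K); apply: measurableC; apply: open_measurable_prod.
by apply: closed_openC; apply: compact_closed => //; exact: norm_hausdorff.
Qed.

(** * Test functions *)

Definition vanishes_off (R : realType) (M : R) (u : R -> R -> R) :=
  forall x t, M < `|x| \/ M < `|t| -> u x t = 0.

Lemma near_gt_norm (R : realType) (M x : R) : M < `|x| ->
  \forall y \near x, M < `|y|.
Proof.
move=> Mx; apply: (@cvgr_gt _ _ (nbhs x) _ (fun y : R => `|y|) `|x|) => //.
exact: (@norm_continuous _ R).
Qed.

Lemma derive1_near0 (R : realType) (f : R -> R) (x : R) :
  (\forall y \near x, f y = 0) -> derive1 f x = 0.
Proof.
move=> f0; rewrite derive1E.
rewrite (@near_eq_derive _ _ _ f (cst 0) x 1) ?oner_neq0//.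
by rewrite derive_cst.
Qed.

Lemma vanishes_off_partial (R : realType) (M : R) (u : R -> R -> R) :
  vanishes_off R M u ->
  vanishes_off R M (partial_x u) /\ vanishes_off R M (partial_t u).
Proof.
move=> u0; split => x t [xM|tM]; apply: derive1_near0.
- by near=> y; apply: u0; left; near: y; exact: near_gt_norm.
- by near=> y; apply: u0; right.
- by near=> y; apply: u0; left.
- by near=> y; apply: u0; right; near: y; exact: near_gt_norm.
Unshelve. all: by end_near. Qed.

Lemma vanishes_off_bounded (R : realType) (M : R) (u : R -> R -> R) :
  continuous (fun p : R * R => u p.1 p.2) -> vanishes_off R M u ->
  exists2 B, 0 <= B & forall x t, `|u x t| <= B.
Proof.
move=> cu u0.
pose D : set (R * R) := `[(- M), M]%classic `*` `[(- M), M]%classic.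
have cD : compact D by apply: compact_setX; exact: segment_compact.
have cu' : {within D, continuous (fun p : R * R =>
  u p.1 p.2)} by exact: continuous_subspaceT.
have /compact_bounded[N [_ mrt]] := continuous_compact cu' cD.
exists (`|N| + 1) => [|x t]; first by rewrite addr_ge0.
have [xM|xM] := ltP M `|x|; first by rewrite u0 ?normr0 ?addr_ge0//; left.
have [tM|tM] := ltP M `|t|; first by rewrite u0 ?normr0 ?addr_ge0//; right.
apply: mrt; first by rewrite ltr_pwDr// ler_norm.
by exists (x, t) => //; split; rewrite /= in_itv/= -ler_norml.
Qed.

Lemma test_function_vanishes_off (R : realType) (phi : R -> R -> R) :
  test_function phi -> exists2 M, 0 < M & vanishes_off R M phi.
Proof.
move=> [_ /compact_bounded[N [_ Nb]]]; exists (`|N| + 1) => [|x t xt].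
  by rewrite ltr_wpDl.
apply/eqP; apply: contrapT => /negP h.
have : closure [set p : R * R | phi p.1 p.2 != 0] (x,
  t) by exact: subset_closure.
move=> /(Nb (`|N| + 1) ltac:(by rewrite ltr_pwDr// ler_norm)).
rewrite /= prod_normE/= ge_max => /andP[]; case: xt; lra.
Qed.

(** * Pairing a self-similar kernel with a function on the plane *)

(** The kernel [P (k t * x) * k t] need not be bounded by a product of
    integrable functions near the time where [k] blows up, but its integral
    over each time slice is that of [P], whatever [k t] is. Tonelli's theorem
    therefore gives integrability, and scaling every slice moves the dependence
    on [k t] from the kernel to the function it is paired with. *)
Section kernel_pairing.
Context (R : realType) (P k : R -> R).
Hypothesis intP : mu.-integrable setT (EFin \o P).
Hypothesis mk : measurable_fun setT k.
Hypothesis k_gt0 : forall t, 0 < t -> 0 < k t.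
Hypothesis k0 : forall t, t <= 0 -> k t = 0.

Let mP : measurable_fun setT P.
Proof. by case/integrableP : intP => /measurable_EFinP. Qed.

Let K (p : R * R) := P (k p.2 * p.1) * k p.2.

Lemma kernel_measurable : measurable_fun setT K.
Proof.
have mk2 : measurable_fun setT (fun p : R * R =>
  k p.2) by exact: measurableT_comp.
apply: measurable_funM => //; apply: measurableT_comp => //.
exact: measurable_funM.
Qed.

Context (u : R * R -> R) (b : R -> R).
Hypothesis measurable_u : measurable_fun setT u.
Hypothesis intb : mu.-integrable setT (EFin \o b).
Hypothesis ub : forall x t, `|u (x, t)| <= b t.

Let b0 t : 0 <= b t. Proof. exact: le_trans (ub 0 t). Qed.

Let mKu : measurable_fun setT (EFin \o (fun p => K p * u p)).
Proof. by apply/measurable_EFinP; apply: measurable_funM => //;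
  exact: kernel_measurable. Qed.

Let mKu1 t : measurable_fun setT (fun x => (K (x, t) * u (x, t))%:E).
Proof. by apply: (measurableT_comp mKu); exact: measurable_pair2. Qed.

Let IP : (\int[mu]_y `|(P y)%:E| \is a fin_num)%E.
Proof. by apply: integrable_fin_num => //; exact: integrable_abse. Qed.

Let section_abs (t : R) :
  (\int[mu]_x `|(K (x, t) * u (x, t))%:E| <= (b t)%:E * \int[mu]_y `|(P
    y)%:E|)%E.
Proof.
have [t0|t0] := leP t 0.
  rewrite integral0_eq; first by rewrite mule_ge0 ?lee_fin// integral_ge0.
  by move=> x _; rewrite /K/= k0// mulr0 mul0r normr0.
have mPk : measurable_fun setT (fun x => `|(P (k t * x))%:E|)%E.
  apply: measurableT_comp => //; apply/measurable_EFinP.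
  by apply: measurableT_comp => //; exact: mulrl_measurable.
rewrite -(ge0_integral_scale _ _ (k_gt0 _ t0) (fun y => `|(P y)%:E|)%E)//;
  last first.
  by apply: measurableT_comp => //; exact/measurable_EFinP.
rewrite -ge0_integralZl//; last 3 first.
- by apply: emeasurable_funM; [exact: mPk|exact: measurable_cst].
- by move=> x _; rewrite mule_ge0// lee_fin ltW// k_gt0.
- by rewrite lee_fin.
apply: ge0_le_integral => //.
- by apply: measurableT_comp => //; exact: mKu1.
- apply: emeasurable_funM; first exact: measurable_cst.
  by apply: emeasurable_funM; [exact: mPk|exact: measurable_cst].
- move=> x _; rewrite /K/= -!EFinM lee_fin !normrM mulrC (gtr0_norm (k_gt0 _
    t0)).
  by rewrite ler_wpM2r// mulr_ge0// ltW// k_gt0.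
Qed.

Lemma kernel_integrable :
  (mu \x mu)%E.-integrable setT (EFin \o (fun p => K p * u p)).
Proof.
apply/integrable21ltyP; first exact: mKu.
have intbP : mu.-integrable setT (fun t => (b t)%:E * \int[mu]_y `|(P y)%:E|)%E.
  rewrite -(fineK IP).
  exact: (integrableZr measurableT (fine (\int[mu]_y `|(P y)%:E|)%E) intb).
apply: le_lt_trans (integrable_lty measurableT intbP).
apply: ge0_le_integral => //.
- by move=> x _; exact: integral_ge0.
- have mabs : measurable_fun setT (abse \o (EFin \o (fun p => K p * u p))).
    by apply: measurableT_comp => //; exact: mKu.
  exact: (@measurable_fun_fubini_tonelli_G _ _ _ _ _ mu _ mabs (fun=> abse_ge0
    _)).
- exact: measurable_int intbP.
- by move=> t _; exact: section_abs.
Qed.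

Lemma kernel_section_integrable (t : R) :
  mu.-integrable setT (EFin \o (fun x => K (x, t) * u (x, t))).
Proof.
apply/integrableP; split; first exact: mKu1.
by apply: le_lt_trans (section_abs t) _; rewrite -(fineK IP) -EFinM ltry.
Qed.

Lemma kernel_section (t : R) : 0 < t ->
  \int[mu]_x (K (x, t) * u (x, t)) = \int[mu]_y (P y * u (y / k t, t)).
Proof.
move=> t0; have kt := k_gt0 _ t0.
rewrite -(integral_scale _ _ kt (fun y => P y * u (y / k t, t))).
  apply: eq_Rintegral => x _; rewrite /K/= (mulrC (k t) x) mulfK ?gt_eqF//;
    ring.
apply: measurable_funM => //; apply: measurableT_comp => //.
by apply: measurable_fun_pair => //; exact: mulrr_measurable.
Qed.

Lemma kernel_pairing :
  \int[(mu \x mu)%E]_p (K p * u p) =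
  \int[mu]_t (\1_(`]0, +oo[%classic : set R) t * \int[mu]_y (P y * u (y / k t,
    t))).
Proof.
rewrite /Rintegral -(integral21_prod_meas1 kernel_integrable); congr fine.
apply: eq_integral => t _; rewrite /fubini_G indicE mem_setE in_itv/= andbT.
have [t0|t0] := ltP 0 t; last first.
  rewrite mul0r integral0_eq// => x _.
  by rewrite /K/= k0// mulr0 mul0r.
rewrite mul1r -[fine _]/(\int[mu]_y (P y * u (y / k t, t))) -kernel_section//.
rewrite /Rintegral fineK//; apply: integrable_fin_num => //.
exact: kernel_section_integrable.
Qed.

End kernel_pairing.

(** * Differentiation along a curve *)

Lemma mean_value (R : realType) (f df : R -> R) (a b : R) :
  (forall x : R, is_derive x 1 f (df x)) ->
  exists c, `|c - a| <= `|b - a| /\ f b - f a = df c * (b - a).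
Proof.
move=> dfE.
have cf : continuous f.
  by move=> x; case: (dfE x) => h _;
    exact/differentiable_continuous/derivable1_diffP.
have MVT u v : u <= v ->
    exists c, [/\ u <= c, c <= v & f v - f u = df c * (v - u)].
  move=> uv; have [c + E] := @MVT_segment _ f df u v uv (fun x _ =>
    dfE x) (continuous_subspaceT cf).
  by rewrite in_itv/= => /andP[? ?]; exists c.
have [ab|/ltW ba] := leP a b.
  have [c [ac cb E]] := MVT _ _ ab; exists c; split => //.
  by rewrite !ger0_norm; lra.
have [c [bc ca E]] := MVT _ _ ba; exists c; split.
  by rewrite !ler0_norm; lra.
by rewrite -opprB E; ring.
Qed.

(** The increment is split into a step in space at the new time and a step in
    time at the old place; the mean value theorem writes both as values of the
    continuous partial derivatives at points that tend to [(al t, t)]. *)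
Lemma is_derive_curve (R : realType) (u : R -> R -> R) (al : R -> R)
    (dal t : R) :
  (forall x t, derivable (fun y => u y t) x 1) ->
  (forall x t, derivable (u x) t 1) ->
  continuous (fun p : R * R => partial_x u p.1 p.2) ->
  continuous (fun p : R * R => partial_t u p.1 p.2) ->
  is_derive t 1 al dal ->
  is_derive t 1 (fun t => u (al t) t)
    (partial_x u (al t) t * dal + partial_t u (al t) t).
Proof.
move=> dx dt cx ct dalE.
have dxE (v x : R) : is_derive x 1 (fun y => u y v) (partial_x u x v).
  by rewrite /partial_x derive1E; exact/derivableP.
have dtE (x v : R) : is_derive v 1 (u x) (partial_t u x v).
  by rewrite /partial_t derive1E; exact/derivableP.
have /choice[xi xiP] : forall h, exists c,
  `|c - al t| <= `|al (h + t) - al t| /\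
    u (al (h + t)) (h + t) - u (al t) (h + t) = partial_x u c (h + t) * (al (h
      + t) - al t).
  by move=> h; exact: (mean_value _ _ _ _ _ (dxE (h + t))).
have /choice[eta etaP] : forall h, exists c, `|c - t| <= `|h + t - t| /\
    u (al t) (h + t) - u (al t) t = partial_t u (al t) c * (h + t - t).
  by move=> h; exact: (mean_value _ _ _ _ _ (dtE (al t))).
have h0 : h @[h --> (0 : R)^'] --> (0 : R) by exact: cvg_within.
have ht : h + t @[h --> (0 : R)^'] --> t.
  by rewrite -[X in _ --> X]add0r; apply: cvgD => //; exact: cvg_cst.
have dal_cvg : h^-1 *: (al (h *: 1 + t) - al t) @[h --> (0 : R)^'] --> dal.
  have [d E] := dalE.
  by have : h^-1 *: (al (h *: 1 + t) - al t) @[h --> (0 : R)^'] -->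
    'D_1 al t by []; rewrite E.
have cal : al h @[h --> t] --> al t.
  by case: dalE => d _; exact/differentiable_continuous/derivable1_diffP.
have alh : al (h + t) @[h --> (0 : R)^'] --> al t by exact: cvg_comp ht cal.
have xi_cvg : xi h @[h --> (0 : R)^'] --> al t.
  move/cvgrPdist_le : (alh) => hd; apply/cvgrPdist_le => e e0.
  have := hd e e0; apply: filterS => h.
  by rewrite distrC => hh; rewrite distrC (le_trans (xiP h).1).
have eta_cvg : eta h @[h --> (0 : R)^'] --> t.
  move/cvgrPdist_le : (ht) => hd; apply/cvgrPdist_le => e e0.
  have := hd e e0; apply: filterS => h.
  by rewrite distrC => hh; rewrite distrC (le_trans (etaP h).1).
have ux_cvg : partial_x u (xi h) (h + t) @[h --> (0 : R)^'] -->
  partial_x u (al t) t.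
  exact: (@cvg_comp _ _ _ (fun h => (xi h, h + t)) (fun p : R * R =>
    partial_x u p.1 p.2)
    _ _ _ (cvg_pair xi_cvg ht) (cx (al t, t))).
have ut_cvg : partial_t u (al t) (eta h) @[h --> (0 : R)^'] -->
  partial_t u (al t) t.
  exact: (@cvg_comp _ _ _ (fun h => (al t, eta h)) (fun p : R * R =>
    partial_t u p.1 p.2)
    _ _ _ (cvg_pair (cvg_cst (al t)) eta_cvg) (ct (al t, t))).
have H : h^-1 *: (u (al (h *: 1 + t)) (h *: 1 + t) - u (al t) t) @[h -->
  (0:R)^'] -->
    partial_x u (al t) t * dal + partial_t u (al t) t.
  apply: cvg_trans (cvgD (cvgM ux_cvg dal_cvg) ut_cvg).
  apply: near_eq_cvg; rewrite near_withinE; near=> h => hN0.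
  rewrite /= [h%:A]mulr1.
  rewrite (_ : u (al (h + t)) (h + t) - u (al t) t =
    (u (al (h + t)) (h + t) - u (al t) (h + t)) + (u (al t) (h + t) - u (al t)
      t)); last by ring.
  rewrite (xiP h).2 (etaP h).2.
  transitivity (partial_x u (xi h) (h + t) * (h^-1 * (al (h * 1 + t) - al t)) +
    partial_t u (al t) (eta h)); first by [].
  by rewrite mulr1 /GRing.scale/=; field.
apply: DeriveDef; first by apply/cvg_ex; eexists; exact: H.
exact: (cvg_lim _ H).
Unshelve. all: by end_near. Qed.

Lemma continuous_halfline_extension (R : realType) (f : R -> R) :
  (forall t : R, 0 < t -> {for t, continuous f}) ->
  f t @[t --> 0^'+] --> f 0 ->
  continuous (fun t : R => f (Num.max t 0)).
Proof.
move=> cf f0 t.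
have [t0|t0|->] := ltgtP t 0.
- have : \forall y \near t, cst (f 0) y = f (Num.max y 0).
    near=> y; congr f; apply/esym/max_idPr/ltW; near: y; exact: lt_nbhsl.
  move/near_eq_cvg/cvg_trans; rewrite /continuous_at (max_idPr (ltW t0)); apply.
  exact: cvg_cst.
- have : \forall y \near t, f y = f (Num.max y 0).
    near=> y; congr f; apply/esym/max_idPl/ltW; near: y; exact: lt_nbhsr.
  move/near_eq_cvg/cvg_trans; rewrite /continuous_at (max_idPl (ltW t0)); apply.
  exact: cf.
- rewrite /continuous_at maxxx; apply/cvgrPdist_le => e e0.
  move/cvgrPdist_le : f0 => /(_ e e0); rewrite !near_withinE =>
    /nbhs_ballP[d /= d0 fd].
  apply/nbhs_ballP; exists d => //= y yd.
  have [y0|y0] := leP y 0; first by rewrite subrr normr0 ltW.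
  exact: fd.
Unshelve. all: by end_near. Qed.

(** * Transport along the curves of constant similarity variable *)

(** The density [P] is supported where [`|y| <= s]; the curve of parameter [y]
    is [x = rt t * (y / s)], and all curves start at the origin. *)
Section transport.
Context (R : realType) (P rt drt : R -> R) (s c0 : R).
Hypothesis s_gt0 : 0 < s.
Hypothesis intP : mu.-integrable setT (EFin \o P).
Hypothesis P_supp : forall y, s < `|y| -> P y = 0.
Hypothesis crt : continuous rt.
Hypothesis cdrt : continuous drt.
Hypothesis rtE : forall t : R, 0 < t -> is_derive t 1 rt (drt t).
Hypothesis rt0 : rt 0 = 0.
Hypothesis drt_le : forall t, `|drt t| <= c0.

Let pos : R -> R := \1_(`]0, +oo[%classic : set R).
Let q (y : R) := P y * (y / s).

Lemma moment_integrable : mu.-integrable setT (EFin \o q).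
Proof.
apply: (@le_integrable _ _ _ mu setT measurableT _ (EFin \o P)) => //.
- apply/measurable_EFinP; apply: measurable_funM; last exact: mulrr_measurable.
  by case/integrableP : intP => /measurable_EFinP.
- move=> y _ /=; rewrite lee_fin /q normrM.
  have [sy|ys] := ltP s `|y|; first by rewrite P_supp// normr0 mul0r.
  by rewrite ler_piMr// normrM normfV (gtr0_norm s_gt0) ler_pdivrMr// mul1r.
Qed.

(** The common form of all integrands in the variables [(t, y)]: a function of
    time, a weight in [y], and a function on the plane evaluated along the
    curve. *)
Definition curve_weight (e q : R -> R) (w : R -> R -> R) (p : R * R) :=
  e p.1 * (q p.2 * w (rt p.1 * (p.2 / s)) p.1).

Definition product_dominated (K : R * R -> R) := exists f g : R -> R,
  [/\ mu.-integrable setT (EFin \o f), mu.-integrable setT (EFin \o g),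
      forall x, 0 <= f x, forall y, 0 <= g y &
      forall x y, `|K (x, y)| <= f x * g y].

Lemma product_dominatedD (K1 K2 : R * R -> R) : product_dominated K1 ->
  product_dominated K2 ->
  product_dominated (fun p => K1 p + K2 p).
Proof.
move=> [f1 [g1 [if1 ig1 f10 g10 h1]]] [f2 [g2 [if2 ig2 f20 g20 h2]]].
exists (fun x => f1 x + f2 x), (fun y => g1 y + g2 y); split.
- by have := integrableD measurableT if1 if2; apply: eq_integrable.
- by have := integrableD measurableT ig1 ig2; apply: eq_integrable.
- by move=> x; rewrite addr_ge0.
- by move=> y; rewrite addr_ge0.
- move=> x y; rewrite (le_trans (ler_normD _ _))// (le_trans (lerD (h1 x y) (h2
    x y)))//.
  have k1 := mulr_ge0 (f10 x) (g20 y); have k2 := mulr_ge0 (f20 x) (g10 y).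
  by rewrite mulrDl !mulrDr; lra.
Qed.

Section weight.
Context (e q' : R -> R) (w : R -> R -> R) (E M : R).
Hypothesis me : measurable_fun setT e.
Hypothesis eE : forall t, `|e t| <= E.
Hypothesis intq : mu.-integrable setT (EFin \o q').
Hypothesis cw : continuous (fun p : R * R => w p.1 p.2).
Hypothesis wM : vanishes_off R M w.

Let mcurve : measurable_fun setT (fun p : R * R => w (rt p.1 * (p.2 / s)) p.1).
Proof.
have mrt : measurable_fun setT (fun p : R * R => rt p.1).
  by apply: measurableT_comp => //; exact: continuous_measurable_fun.
apply: (measurableT_comp (continuous_measurable_prod _ _ cw)
  (g := fun p : R * R => (rt p.1 * (p.2 / s), p.1))).
apply: measurable_fun_pair => //; apply: measurable_funM => //.
exact: measurable_funM.
Qed.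

Lemma curve_weight_measurable : measurable_fun setT (curve_weight e q' w).
Proof.
apply: measurable_funM; first exact: measurableT_comp.
apply: measurable_funM => //; apply: measurableT_comp => //.
by case/integrableP : intq => /measurable_EFinP.
Qed.

Lemma curve_weight_product_dominated : product_dominated (curve_weight e q' w).
Proof.
have [B B0 wB] := vanishes_off_bounded _ _ _ cw wM.
exists (\1_(`[(- M), M]%classic : set R) \* cst (E * B)), (fun y => `|q' y|).
have E0 : 0 <= E by apply: le_trans (eE 0).
split.
- have := @integrable_indic_itv R (- M) M true false.
  move=> h; have := integrableZr measurableT (E * B) h.
  by apply: eq_integrable.
- exact: integrable_norm.
- by move=> x; rewrite /= mulr_ge0// ?mulr_ge0.
- by [].
- move=> x y; rewrite /curve_weight/= !normrM indicE mem_setE in_itv/=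
    -ler_norml.
  have [xM|xM] := leP `|x| M; last by rewrite wM ?normr0 ?mulr0 ?mul0r//; right.
  rewrite mul1r -mulrA [B * _]mulrC.
  by apply: ler_pM => //; exact: ler_wpM2l.
Qed.

Lemma curve_weight_section (t : R) :
  \int[mu]_y curve_weight e q' w (t, y) =
  e t * \int[mu]_y (q' y * w (rt t * (y / s)) t).
Proof.
rewrite /curve_weight/= RintegralZl//.
have [B B0 wB] := vanishes_off_bounded _ _ _ cw wM.
apply: (@le_integrable _ _ _ mu setT measurableT _ (EFin \o (fun y =>
  B * q' y))).
- apply/measurable_EFinP; apply: measurable_funM.
    by case/integrableP : intq => /measurable_EFinP.
  exact: (measurableT_comp mcurve (measurable_pair1 t)).
- by move=> y _ /=; rewrite lee_fin !normrM mulrC ler_wpM2r// (le_trans (wB _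
    _))// ler_norm.
- exact: (integrableZl measurableT B intq).
Qed.

Lemma curve_weight_integrable : mu.-integrable setT
  (EFin \o (fun t => e t * \int[mu]_y (q' y * w (rt t * (y / s)) t))).
Proof.
have [f [g [intf intg _ _ Kfg]]] := curve_weight_product_dominated.
have := dominated_Rintegral1 _ _ _ _ curve_weight_measurable intf intg Kfg.
by apply: eq_integrable => // t _ /=; rewrite curve_weight_section.
Qed.

End weight.

Context (phi : R -> R -> R) (M : R).
Hypothesis M_gt0 : 0 < M.
Hypothesis phiM : vanishes_off R M phi.
Hypothesis cphi : continuous (fun p : R * R => phi p.1 p.2).
Hypothesis dxphi : forall x t, derivable (fun y => phi y t) x 1.
Hypothesis dtphi : forall x t, derivable (phi x) t 1.
Hypothesis cxphi : continuous (fun p : R * R => partial_x phi p.1 p.2).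
Hypothesis ctphi : continuous (fun p : R * R => partial_t phi p.1 p.2).

Let curve_continuous (w : R -> R -> R) (a : R) :
  continuous (fun p : R * R => w p.1 p.2) -> continuous (fun t =>
    w (rt t * a) t).
Proof.
move=> cw t.
have ca : rt u * a @[u --> t] --> rt t * a by apply: cvgMl; exact: crt.
have ct : u @[u --> t] --> t by exact: cvg_id.
exact: (@cvg_comp _ _ _ (fun t => (rt t * a, t)) (fun p : R * R => w p.1 p.2)
  _ _ _ (cvg_pair ca ct) (cw (rt t * a, t))).
Qed.

Let velocity (a t : R) :=
  partial_x phi (rt t * a) t * (drt t * a) + partial_t phi (rt t * a) t.

Let velocity_continuous a : continuous (velocity a).
Proof.
move=> t; apply: cvgD; last exact: curve_continuous.
apply: cvgM; first exact: curve_continuous.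
by apply: cvgMl; exact: cdrt.
Qed.

Let velocity_patch a :
  (fun t => pos t * velocity a t) = velocity a \_ `]0, M + 1].
Proof.
have [xphi0 tphi0] := vanishes_off_partial _ _ _ phiM.
apply/funext => t.
rewrite patchE mem_setE in_itv/= /pos indicE mem_setE in_itv/= andbT.
have [t0|t0] := ltP 0 t; last by rewrite mul0r.
rewrite mul1r; have [//|tM] := leP t (M + 1).
have Mt : M < `|t| by rewrite gtr0_norm; lra.
by rewrite /velocity xphi0 ?tphi0 ?mul0r ?addr0//; right.
Qed.

Let velocity_integrable a : mu.-integrable `]0, M + 1] (EFin \o velocity a).
Proof.
apply: integrableS (continuous_integrable_itv _ _ 0 (M + 1)
  (velocity_continuous a)) => //.
exact: subset_itv_oc_cc.
Qed.

Lemma velocity_integral (a : R) :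
  \int[mu]_t (pos t * velocity a t) = - phi 0 0.
Proof.
have M1 : 0 < M + 1 by rewrite addr_gt0.
pose z (t : R) := phi (rt t * a) t.
have cz : continuous z by exact: curve_continuous.
have dz (t : R) : 0 < t -> is_derive t 1 z (velocity a t).
  move=> t0; apply: is_derive_curve => //.
  have dt := rtE _ t0.
  rewrite (_ : (fun t => rt t * a) = a \*: rt); last by apply/funext => u;
    rewrite mulrC.
  by rewrite (mulrC (drt t)); exact: is_deriveZ.
have zE : \int[mu]_(t in `[0, M + 1]) velocity a t = z (M + 1) - z 0.
  rewrite /Rintegral (@continuous_FTC2 _ (velocity a) z)//.
  - exact: continuous_subspaceT.
  - split => [x||]; last 2 first.
    + by apply: cvg_at_right_filter; exact: cz.
    + by apply: cvg_at_left_filter; exact: cz.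
    + by rewrite in_itv/= => /andP[x0 _]; case: (dz _ x0).
  - by move=> x; rewrite in_itv/= => /andP[x0 _]; rewrite derive1E;
      case: (dz _ x0).
rewrite -[RHS]add0r -[X in _ = X + _](_ : z (M + 1) = 0); last first.
  by rewrite /z phiM//; right; rewrite gtr0_norm; lra.
rewrite [X in _ = _ - X](_ : _ = z 0); last by rewrite /z rt0 mul0r.
rewrite -zE -Rintegral_itv_obnd_cbnd; last exact: velocity_integrable.
by rewrite [RHS]Rintegral_mkcond -velocity_patch.
Qed.

(** After exchanging the integrals, the inner one runs over the derivative of
    [phi] along a curve that starts at the origin and leaves the support of
    [phi]; hence it equals [- phi 0 0] for every [y]. *)
Lemma transport_identity :
  \int[mu]_t (pos t * \int[mu]_y (P y * partial_t phi (rt t * (y / s)) t)) +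
  \int[mu]_t (pos t * drt t * \int[mu]_y (q y * partial_x phi (rt t * (y / s))
    t)) =
  - (phi 0 0 * \int[mu]_y P y).
Proof.
have [xphi0 tphi0] := vanishes_off_partial _ _ _ phiM.
have mpos : measurable_fun setT pos by exact: measurable_indic.
have pos1 t : `|pos t| <= 1.
  by rewrite /pos indicE; case: (_ \in _); rewrite ?normr1 ?normr0.
have mpd : measurable_fun setT (fun t => pos t * drt t).
  by apply: measurable_funM => //; exact: continuous_measurable_fun.
have pd1 t : `|pos t * drt t| <= c0.
  rewrite normrM -[X in _ <= X]mul1r; exact: ler_pM.
pose K1 := curve_weight pos P (partial_t phi).
pose K2 := curve_weight (fun t => pos t * drt t) q (partial_x phi).
have intq := moment_integrable.
have dK1 : product_dominated K1 by exact: (curve_weight_product_dominated _ _ _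
  _ _ pos1 intP ctphi tphi0).
have dK2 : product_dominated K2 by exact: (curve_weight_product_dominated _ _ _
  _ _ pd1 intq cxphi xphi0).
have mK1 : measurable_fun setT K1 by exact: curve_weight_measurable.
have mK2 : measurable_fun setT K2 by exact: curve_weight_measurable.
have mK : measurable_fun setT (fun p => K1 p + K2 p) by exact: measurable_funD.
have [f1 [g1 [intf1 intg1 _ _ K1fg]]] := dK1.
have [f2 [g2 [intf2 intg2 _ _ K2fg]]] := dK2.
have [f [g [intf intg _ _ Kfg]]] := product_dominatedD _ _ dK1 dK2.
have i1 := curve_weight_integrable _ _ _ _ _ mpos pos1 intP ctphi tphi0.
have i2 := curve_weight_integrable _ _ _ _ _ mpd pd1 intq cxphi xphi0.
apply: etrans (esym (RintegralD measurableT i1 i2)) _.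
transitivity (\int[mu]_t \int[mu]_y (K1 (t, y) + K2 (t, y))).
  apply: eq_Rintegral => t _; rewrite RintegralD//.
  - by rewrite (curve_weight_section _ _ _ _ intP ctphi tphi0)
      (curve_weight_section _ _ _ _ intq cxphi xphi0).
  - exact: (dominated_section1 _ _ _ _ mK1 intg1 K1fg).
  - exact: (dominated_section1 _ _ _ _ mK2 intg2 K2fg).
rewrite -(dominated_prod12 _ _ _ _ mK intf intg Kfg) (dominated_prod21 _ _ _ _
  mK intf intg Kfg).
rewrite -mulNr -RintegralZl//; apply: eq_Rintegral => y _.
have vint : mu.-integrable setT (EFin \o (fun t => pos t * velocity (y / s) t)).
  by rewrite velocity_patch; apply: integrable_patch => //;
    exact: velocity_integrable.
transitivity (P y * \int[mu]_t (pos t * velocity (y / s) t)); last first.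
  by rewrite velocity_integral mulrC.
apply: etrans (RintegralZl (P y) measurableT vint).
by apply: eq_Rintegral => t _; rewrite /K1 /K2 /curve_weight/= /velocity /q;
  ring.
Qed.

End transport.

(** * The attenuation term at a fixed time *)

Section slices.
Context (R : realType) (T tau0 D0 : R) (ell rho r : R -> R) (t : R).
Hypothesis T_gt0 : 0 < T.
Hypothesis tau0_gt0 : 0 < tau0.
Hypothesis ell_control : control_term T tau0 ell.
Hypothesis rho_relaxation : relaxation_function T tau0 ell rho.
Hypothesis rt_gt0 : 0 < r t.

Let s := Num.sqrt T.
Let N := normalization T rho / Num.sqrt pi.
Let a := (s / r t) ^+ 2.

Let s_gt0 : 0 < s. Proof. by rewrite sqrtr_gt0. Qed.
Let a_gt0 : 0 < a. Proof. by rewrite exprn_gt0// divr_gt0. Qed.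
Let TE : T = s ^+ 2. Proof. by rewrite sqr_sqrtr// ltW. Qed.

Lemma similarity_sqE x : similarity T r x t ^+ 2 = a * x ^+ 2.
Proof. by rewrite /similarity -/s /a mulrAC exprMn. Qed.

Let derive_square (x : R) :
  derive1 (fun y => similarity T r y t ^+ 2) x = 2 * a * x.
Proof.
rewrite derive1E; apply: derive_val.
apply: (is_derive_quadratic _ _ a) => h; rewrite !similarity_sqE.
have -> : a * (x + h) ^+ 2 - a * x ^+ 2 - 2 * a * x * h = a * h ^+ 2 by ring.
by rewrite ger0_norm// mulr_ge0 ?sqr_ge0// ltW.
Qed.

Context (psi dpsi ddpsi : R -> R) (M : R).
Hypothesis M_ge0 : 0 <= M.
Hypothesis dpsiE : forall x : R, is_derive x 1 psi (dpsi x).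
Hypothesis ddpsiE : forall x : R, is_derive x 1 dpsi (ddpsi x).
Hypothesis cddpsi : continuous ddpsi.
Hypothesis psi0 : forall x, M <= `|x| -> psi x = 0.
Hypothesis dpsi0 : forall x, M <= `|x| -> dpsi x = 0.
Hypothesis ddpsi0 : forall x, M <= `|x| -> ddpsi x = 0.

Let E := N * (s / r t ^+ 2).
Let r1 := derive1 r t - 2 * T * D0 / (tau0 * r t).
Let b := E * (2 * T * D0 / r t).

Let dxpsi (f df : R -> R) : (forall x : R, is_derive x 1 f (df x)) ->
  forall x : R, is_derive x 1 (fun y => y * f y) (f x + x * df x).
Proof.
move=> dfE x; have := is_deriveM (is_derive_id x 1) (dfE x).
by rewrite /GRing.scale/= mulr1 addrC.
Qed.

(** The quotient in [deriv_comp_dist] is [b * (y * psi y)] for all [y]: at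
    [y = 0] the value of the division by zero is the right one. *)
Let deriv_quotient x :
  derive1 (fun y => coef_a2 T D0 rho r y t * psi y /
    derive1 (fun z => similarity T r z t ^+ 2) y) x = b * (psi x + x * dpsi x).
Proof.
have -> : (fun y => coef_a2 T D0 rho r y t * psi y /
    derive1 (fun z => similarity T r z t ^+ 2) y) = b \*: (fun y => y * psi y).
  apply/funext => y; rewrite -[RHS]/(b * (y * psi y)) derive_square /coef_a2
    similarity_sqE -/N.
  have -> : T `^ (3 / 2) = s ^+ 3.
    have -> : 3 / 2 = 1 + 2^-1 :> R by lra.
    rewrite powRD ?powRr1 ?ltW// ?powR12_sqrt ?ltW//; last first.
      by rewrite gt_eqF//= implybT.
    by rewrite -/s [X in X * _]TE -exprSr.
  have [->|y0] := eqVneq y 0.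
    by rewrite expr0n/= !(mulr0, mul0r).
  have -> : b = N * (s / r t ^+ 2) * (2 * s ^+ 2 * D0 / r t) by rewrite -TE.
  have aN0 : a != 0 by rewrite gt_eqF.
  by field; rewrite y0 aN0 gt_eqF.
by rewrite derive1E; apply: derive_val; apply: is_deriveZ; exact: dxpsi.
Qed.

(** Expanding the coefficients leaves the integrals of [ell (a * x ^+ 2)]
    against [psi], [x * dpsi x] and [x * (x * psi x)]. The first cancels between
    the terms with [coef_a1] and [coef_a2]; [control_square_moment] expresses
    the other two by [rho], and then all terms without a derivative of [psi]
    cancel as well. *)
Lemma atten_sliceE :
  atten_slice T tau0 D0 ell rho r t psi =
  - (E * derive1 r t) * \int[mu]_x (rho (a * x ^+ 2) * (x * dpsi x)) +
  (N * (s / r t)) * D0 * \int[mu]_x (rho (a * x ^+ 2) * ddpsi x).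
Proof.
have cpsi (f df : R -> R) : (forall x : R, is_derive x 1 f (df x)) ->
  continuous f.
  by move=> dfE x; case: (dfE x) => h _;
    exact/differentiable_continuous/derivable1_diffP.
have cx (f : R -> R) : continuous f -> continuous (fun x : R => x * f x).
  by move=> cf x; apply: cvgM; [exact: cvg_id|exact: cf].
have x0 (f : R -> R) : (forall x : R, M <= `|x| -> f x = 0) ->
    forall x : R, M <= `|x| -> x * f x = 0 by move=> f0 x /f0 ->; rewrite mulr0.
have c0 := cpsi _ _ dpsiE; have c1 := cpsi _ _ ddpsiE.
have lr := relaxation_square_locally_integrable _ _ _ _ _ a T_gt0
  rho_relaxation.
have le := control_square_locally_integrable _ _ _ _ _ ell_control a_gt0.
have [J0 _] := integrable_compact_support _ _ _ M lr c0 psi0.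
have [J1 _] := integrable_compact_support _ _ _ M lr (cx _ c1) (x0 _ dpsi0).
have [J2 _] := integrable_compact_support _ _ _ M lr (cx _ (cx _ c0)) (x0 _ (x0
  _ psi0)).
have [L0 _] := integrable_compact_support _ _ _ M le c0 psi0.
have [L1 _] := integrable_compact_support _ _ _ M le (cx _ c1) (x0 _ dpsi0).
have [L2 _] := integrable_compact_support _ _ _ M le (cx _ (cx _ c0)) (x0 _ (x0
  _ psi0)).
have m1 := control_square_moment _ _ _ _ _ _ T_gt0 tau0_gt0 ell_control
  rho_relaxation
  a_gt0 M _ _ M_ge0 ddpsiE cddpsi dpsi0 ddpsi0.
have cd : continuous (fun x : R => psi x + x * dpsi x).
  by move=> x; apply: cvgD; [exact: c0|exact: cx].
have d0 x : M <= `|x| -> psi x + x * dpsi x = 0.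
  by move=> xM; rewrite psi0// dpsi0// mulr0 addr0.
have m2 := control_square_moment _ _ _ _ _ _ T_gt0 tau0_gt0 ell_control
  rho_relaxation
  a_gt0 M _ _ M_ge0 (dxpsi _ _ dpsiE) cd (x0 _ psi0) d0.
have ZI (f : R -> R) (z : R) : mu.-integrable setT (EFin \o f) ->
    mu.-integrable setT (EFin \o (fun x => z * f x)).
  by move=> fi; exact: (integrableZl measurableT z fi).
have lin (f g : R -> R) (y z : R) : mu.-integrable setT (EFin \o f) ->
    mu.-integrable setT (EFin \o g) ->
    \int[mu]_x (y * f x + z * g x) = y * \int[mu]_x f x + z * \int[mu]_x g x.
  move=> fi gi; apply: etrans (RintegralD measurableT (ZI _ y fi) (ZI _ z gi))
    _.
  by congr (_ + _); [exact: (RintegralZl y measurableT fi)|exact: (RintegralZl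
    z measurableT gi)].
rewrite /atten_slice /regular_dist1 /deriv_comp_dist opprK.
transitivity (- (E * r1 * (2 / tau0 * a) * \int[mu]_x (rho (a * x ^+ 2) * (x *
  (x * psi x))) +
    - (E * r1) * \int[mu]_x (rho (a * x ^+ 2) * psi x))
  - (2 * E * r1 * a * \int[mu]_x (ell (a * x ^+ 2) * (x * (x * psi x))) +
    b * \int[mu]_x (ell (a * x ^+ 2) * psi x))
  + (b * \int[mu]_x (ell (a * x ^+ 2) * psi x) +
    b * \int[mu]_x (ell (a * x ^+ 2) * (x * dpsi x)))).
  rewrite -!lin//; congr (- _ - _ + _); apply: eq_Rintegral => x _.
  - by rewrite /coef_a0 similarity_sqE -/N -/s -/E -/r1; ring.
  - by rewrite /coef_a1 similarity_sqE -/N -/s -/E -/r1 /b; ring.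
  - by rewrite deriv_quotient similarity_sqE; ring.
rewrite m1 m2.
have -> : \int[mu]_x (rho (a * x ^+ 2) * (psi x + x * dpsi x)) =
    1 * \int[mu]_x (rho (a * x ^+ 2) * psi x) + 1 * \int[mu]_x (rho (a * x ^+
      2) * (x * dpsi x)).
  by rewrite -lin//; apply: eq_Rintegral => x _; ring.
have -> : b = E * (2 * s ^+ 2 * D0 / r t) by rewrite -TE.
have -> : r1 = derive1 r t - 2 * s ^+ 2 * D0 / (tau0 * r t) by rewrite -TE.
rewrite /E /a; field.
by rewrite !gt_eqF.
Qed.

End slices.

(** * The equation of the generalized Gaussian *)

Section pulse.
Context (R : realType) (T tau0 D0 c0 : R) (ell rho r dr : R -> R).
Hypothesis T_gt0 : 0 < T.
Hypothesis tau0_gt0 : 0 < tau0.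
Hypothesis ell_control : control_term T tau0 ell.
Hypothesis rho_relaxation : relaxation_function T tau0 ell rho.
Hypothesis N_defined : profile_integral T rho != 0.
Hypothesis r0 : r 0 = 0.
Hypothesis r_gt0 : forall t, 0 < t -> 0 < r t.
Hypothesis drP : C1_halfline r dr.
Hypothesis dr_bound : forall t, 0 <= t -> 0 < dr t <= c0.

Let s := Num.sqrt T.
Let N := normalization T rho / Num.sqrt pi.
Let P (y : R) := N * rho (y ^+ 2).
Let q (y : R) := P y * (y / s).
(* Extending r and its derivative by constants to t < 0 makes them continuous
   on the whole line. *)
Let rt (t : R) := r (Num.max t 0).
Let drt (t : R) := dr (Num.max t 0).
Let k (t : R) := if 0 < t then s / r t else 0.
Let pos : R -> R := \1_(`]0, +oo[%classic : set R).

Let s_gt0 : 0 < s. Proof. by rewrite sqrtr_gt0. Qed.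

Let rho_sq_supp y : s < `|y| -> rho (y ^+ 2) = 0.
Proof.
move=> sy; apply: (relaxation_supp _ _ _ _ _ rho_relaxation); right.
rewrite -[T]sqr_sqrtr ?ltW// -/s -(real_normK (num_real y)).
by rewrite ltr_sqr ?nnegrE// ltW.
Qed.

Let P_supp y : s < `|y| -> P y = 0.
Proof. by move=> /rho_sq_supp; rewrite /P => ->; rewrite mulr0. Qed.

Let rho_sq_patch : (fun y => rho (y ^+ 2)) = (fun y =>
  rho (y ^+ 2)) \_ `[(- s), s].
Proof.
apply/funext => y; rewrite patchE mem_setE in_itv/= -ler_norml.
by case: ifPn => //; rewrite -ltNge => /rho_sq_supp.
Qed.

Let int_rho_sq : mu.-integrable setT (EFin \o (fun y : R => rho (y ^+ 2))).
Proof.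
have := relaxation_square_locally_integrable _ _ _ _ _ 1 T_gt0 rho_relaxation.
under eq_fun do rewrite mul1r.
move=> [mf _ lf]; rewrite rho_sq_patch; apply: integrable_patch => //.
apply/integrableP; split; first by apply/measurable_EFinP;
  exact: measurable_funS mf.
exact: (lf `[(- s), s]%classic (@subsetT _ _) (@segment_compact _ _ _)).
Qed.

Let intP : mu.-integrable setT (EFin \o P).
Proof. exact: (integrableZl measurableT N int_rho_sq). Qed.

Let P_mass : \int[mu]_y P y = 1.
Proof.
rewrite /P RintegralZl// rho_sq_patch -Rintegral_mkcond -/(profile_integral T
  rho).
have pi0 : Num.sqrt (pi : R) != 0 by rewrite gt_eqF// sqrtr_gt0 pi_gt0.
by rewrite /N /normalization mulrAC divfK// divff.
Qed.

Let derive_r (t : R) : 0 < t -> is_derive t 1 r (dr t).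
Proof. by case: drP => _ h _; exact: h. Qed.

Let continuous_r (t : R) : 0 < t -> {for t, continuous r}.
Proof.
by move=> /derive_r[h _]; exact/differentiable_continuous/derivable1_diffP.
Qed.

Let crt : continuous rt.
Proof.
apply: continuous_halfline_extension => //.
case: drP => _ _; rewrite r0; under eq_fun do rewrite subr0.
move=> hr; have h0 : h @[h --> (0:R)^'+] --> (0 : R) by exact: cvg_within.
have : h * (r h / h) @[h --> (0 : R)^'+] --> 0 * dr 0 by exact: cvgM.
rewrite mul0r; apply: cvg_trans; apply: near_eq_cvg.
rewrite near_withinE; near=> h => h_gt0; rewrite /= mulrCA divff ?mulr1//.
by rewrite gt_eqF.
Unshelve. all: by end_near. Qed.

Let cdrt : continuous drt.
Proof.
case: drP => /continuous_within_itvcyP[c1 c2] _ _.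
by apply: continuous_halfline_extension => // t t0; apply: c1;
  rewrite in_itv/= t0.
Qed.

Let rtE t : 0 < t -> rt t = r t.
Proof. by move=> t0; rewrite /rt; congr r; apply/max_idPl/ltW. Qed.

Let drtE t : 0 < t -> drt t = dr t.
Proof. by move=> t0; rewrite /drt; congr dr; apply/max_idPl/ltW. Qed.

Let derive_rt (t : R) : 0 < t -> is_derive t 1 rt (drt t).
Proof.
move=> t0; rewrite drtE//; have := derive_r _ t0; apply: near_eq_is_derive.
near=> u; rewrite rtE//; near: u; exact: lt_nbhsr.
Unshelve. all: by end_near. Qed.

Let rt0 : rt 0 = 0. Proof. by rewrite /rt maxxx. Qed.

Let drt_le t : `|drt t| <= c0.
Proof.
have /andP[d0 dc] : 0 < drt t <= c0 by apply: dr_bound;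
  rewrite le_max lexx orbT.
by rewrite gtr0_norm.
Qed.

Let k_gt0 t : 0 < t -> 0 < k t.
Proof. by move=> t0; rewrite /k t0 divr_gt0// r_gt0. Qed.

Let k0 t : t <= 0 -> k t = 0.
Proof. by move=> t0; rewrite /k ltNge t0. Qed.

Let mk : measurable_fun setT k.
Proof.
have -> : k = (fun t => s / r t) \_ `]0, +oo[.
  by apply/funext => t; rewrite patchE mem_setE in_itv/= andbT.
apply/(measurable_restrictT _ _).1 => //.
apply: open_continuous_measurable_fun; first exact: interval_open.
move=> t; rewrite inE/= in_itv/= andbT => t0; apply: cvgMr; apply: cvgV.
  by rewrite gt_eqF// r_gt0.
exact: continuous_r.
Qed.

Let gaussE : gen_gauss T rho r = fun x t => P (k t * x) * k t.
Proof.
apply/funext => x; apply/funext => t; rewrite /gen_gauss /k; case: ifP => t0;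
  last by rewrite mulr0.
have -> : partial_x (similarity T r) x t = s / r t.
  rewrite /partial_x derive1E; apply: derive_val.
  apply: (is_derive_quadratic _ _ 0) => h; rewrite mul0r /similarity -/s.
  have -> : s * (x + h) / r t - s * x / r t - s / r t * h = 0 by ring.
  by rewrite normr0.
have -> : similarity T r x t = s / r t * x by rewrite /similarity -/s; ring.
by rewrite /P -/N; ring.
Qed.

Section test.
Context (phi : R -> R -> R).
Hypothesis phi_test : test_function phi.
Let phix := partial_x phi.
Let phit := partial_t phi.
Let phixx := partial_x phix.

Let phi_C2 : [/\ continuous (fun p : R * R => phi p.1 p.2),
  continuous (fun p : R * R => phix p.1 p.2),
  continuous (fun p : R * R => phit p.1 p.2) &
  continuous (fun p : R * R => phixx p.1 p.2)].
Proof.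
case: phi_test => /(_ 2)[cp [_ _ [cx [_ _ [cxx _] _]] [ct _]]] _.
by split; [exact: cp|exact: cx|exact: ct|exact: cxx].
Qed.

Let phi_derivable : [/\ forall x t, derivable (fun y => phi y t) x 1,
  forall x t, derivable (phi x) t 1 &
  forall x t, derivable (fun y => phix y t) x 1].
Proof.
case: phi_test => /(_ 2)[_ [dx dt [_ [dxx _ _ _]] _]] _.
by split; [exact: dx|exact: dt|exact: dxx].
Qed.

Let cphi : continuous (fun p : R * R =>
  phi p.1 p.2). Proof. by case: phi_C2. Qed.
Let cphix : continuous (fun p : R * R =>
  phix p.1 p.2). Proof. by case: phi_C2. Qed.
Let cphit : continuous (fun p : R * R =>
  phit p.1 p.2). Proof. by case: phi_C2. Qed.
Let cphixx : continuous (fun p : R * R =>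
  phixx p.1 p.2). Proof. by case: phi_C2. Qed.

Let slice_continuous (w : R -> R -> R) t :
  continuous (fun p : R * R => w p.1 p.2) -> continuous (fun x => w x t).
Proof.
move=> cw x; exact: (@cvg_comp _ _ _ (fun x => (x, t)) (fun p : R * R =>
  w p.1 p.2)
  _ _ _ (cvg_pair cvg_id (cvg_cst t)) (cw (x, t))).
Qed.

Let phi_box : exists2 M, 0 < M & [/\ vanishes_off R M phi,
  vanishes_off R M phix,
  vanishes_off R M phit & vanishes_off R M phixx].
Proof.
have [M M0 v] := test_function_vanishes_off _ _ phi_test.
have [vx vt] := vanishes_off_partial _ _ _ v.
have [vxx _] := vanishes_off_partial _ _ _ vx.
by exists M; [exact: M0|split; [exact: v|exact: vx|exact: vt|exact: vxx]].
Qed.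

Let slice_scale (w : R -> R) (C M t : R) : 0 < t -> continuous w ->
  (forall x, M <= `|x| -> w x = 0) ->
  C * \int[mu]_x (rho ((s / r t) ^+ 2 * x ^+ 2) * w x) =
  \int[mu]_y (C / (s / r t) * (rho (y ^+ 2) * w (r t * (y / s)))).
Proof.
move=> t0 cw w0; have rt_gt0 := r_gt0 _ t0.
have k_pos : 0 < s / r t by rewrite divr_gt0.
have lr := relaxation_square_locally_integrable _ _ _ _ _ ((s / r t) ^+ 2)
  T_gt0 rho_relaxation.
have [intw _] := integrable_compact_support _ _ _ M lr cw w0.
have mrho := relaxation_measurable _ _ _ _ _ T_gt0 rho_relaxation.
rewrite -(integral_scale _ _ k_pos
  (fun y => C / (s / r t) * (rho (y ^+ 2) * w (r t * (y / s))))).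
  apply: etrans (esym (RintegralZl C measurableT intw)) _.
  apply: eq_Rintegral => x _; rewrite -[X in rho X]exprMn.
  have -> : r t * (s / r t * x / s) = x by field; rewrite !gt_eqF.
  by field; rewrite !gt_eqF.
apply: measurable_funM => //; apply: measurable_funM;
  first exact: measurableT_comp.
apply: measurableT_comp; first exact: continuous_measurable_fun.
by apply: measurable_funM => //; exact: mulrr_measurable.
Qed.

(** In the similarity variable the attenuation term at time [t] is bounded
    uniformly in [t], although its coefficients blow up as [t] tends to [0]. *)
Lemma atten_slice_scaled t : 0 < t ->
  atten_slice T tau0 D0 ell rho r t (fun x => phi x t) =
  - drt t * \int[mu]_y (q y * phix (rt t * (y / s)) t) +
  D0 * \int[mu]_y (P y * phixx (rt t * (y / s)) t).
Proof.
move=> t0; have rt_gt0 := r_gt0 _ t0.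
have [M M0 [v vx _ vxx]] := phi_box; have [dx _ dxx] := phi_derivable.
have M1 : 0 <= M + 1 by rewrite addr_ge0// ltW.
have v1 (w : R -> R -> R) : vanishes_off R M w -> forall x, M + 1 <= `|x| ->
  w x t = 0.
  by move=> vw x Mx; apply: vw; left; rewrite (lt_le_trans _ Mx)// ltrDl.
have dphiE (x : R) : is_derive x 1 (fun x => phi x t) (phix x t).
  by rewrite /phix /partial_x derive1E; exact/derivableP.
have dphixE (x : R) : is_derive x 1 (fun x => phix x t) (phixx x t).
  by rewrite /phixx /partial_x derive1E; apply/derivableP; exact: dxx.
have cx1 : continuous (fun x => phix x t) by exact: slice_continuous.
have cx2 : continuous (fun x => phixx x t) by exact: slice_continuous.
rewrite (atten_sliceE _ _ _ _ _ _ _ _ T_gt0 tau0_gt0 ell_control rho_relaxation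
  rt_gt0
  _ _ _ _ M1 dphiE dphixE cx2 (v1 _ v) (v1 _ vx) (v1 _ vxx)).
have -> : derive1 r t = drt t.
  by rewrite drtE// derive1E; apply: derive_val; exact: derive_r.
have xphix0 x : M + 1 <= `|x| -> x * phix x t = 0.
  by move=> /(v1 _ vx) ->; rewrite mulr0.
have cxphix : continuous (fun x : R => x * phix x t).
  by move=> x; apply: cvgM; [exact: cvg_id|exact: cx1].
have e1 := slice_scale _ (N * (s / r t ^+ 2)) _ _ t0 cxphix xphix0.
have e2 := slice_scale _ (N * (s / r t)) _ _ t0 cx2 (v1 _ vxx).
have q1 : \int[mu]_y (q y * phix (rt t * (y / s)) t) =
    N * (s / r t ^+ 2) * \int[mu]_x (rho ((s / r t) ^+ 2 * x ^+ 2) * (x * phix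
      x t)).
  rewrite e1; apply: eq_Rintegral => y _; rewrite /q /P rtE//.
  by field; rewrite !gt_eqF.
have q2 : \int[mu]_y (P y * phixx (rt t * (y / s)) t) =
    N * (s / r t) * \int[mu]_x (rho ((s / r t) ^+ 2 * x ^+ 2) * phixx x t).
  rewrite e2; apply: eq_Rintegral => y _; rewrite /P rtE//.
  by field; rewrite !gt_eqF.
have alg (e n d i j : R) :
    - (N * e * d) * i + N * n * D0 * j = - d * (N * e * i) + D0 * (N * n * j)
        by ring.
apply: etrans (alg _ _ _ _ _) _.
exact: (f_equal2 (fun A B => - drt t * A + D0 * B) (esym q1) (esym q2)).
Qed.

Let pairing (w : R -> R -> R) M : continuous (fun p : R * R => w p.1 p.2) ->
  vanishes_off R M w ->
  regular_dist (gen_gauss T rho r) w =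
  \int[mu]_t (pos t * \int[mu]_y (P y * w (rt t * (y / s)) t)).
Proof.
move=> cw vw; have [B B0 wB] := vanishes_off_bounded _ _ _ cw vw.
pose b (t : R) := B * \1_(`[(- M), M]%classic : set R) t.
have intb : mu.-integrable setT (EFin \o b).
  exact: (integrableZl measurableT B (integrable_indic_itv (- M) M true false)).
have wb x t : `|w x t| <= b t.
  rewrite /b indicE mem_setE in_itv/= -ler_norml.
  have [xM|xM] := leP `|t| M; first by rewrite mulr1.
  by rewrite vw ?normr0 ?mulr0//; right.
rewrite /regular_dist gaussE.
have := kernel_pairing _ P k intP mk k_gt0 k0 (fun p => w p.1 p.2) b
  (continuous_measurable_prod _ _ cw) intb wb.
move=> E; apply: etrans E _; apply: eq_Rintegral => t _.
rewrite /pos indicE mem_setE in_itv/= andbT; have [t0|t0] := ltP 0 t;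
  last by rewrite !mul0r.
rewrite !mul1r; apply: eq_Rintegral => y _; rewrite /k t0 rtE//.
by congr (_ * w _ _); field; rewrite !gt_eqF// r_gt0.
Qed.

Let pos1 t : `|pos t| <= 1.
Proof. by rewrite /pos indicE; case: (_ \in _); rewrite ?normr1 ?normr0. Qed.

Let mpos : measurable_fun setT pos. Proof. exact: measurable_indic. Qed.

Let advection t := pos t * drt t * \int[mu]_y (q y * phix (rt t * (y / s)) t).
Let diffusion t := pos t * \int[mu]_y (P y * phixx (rt t * (y / s)) t).

Let advection_integrable : mu.-integrable setT (EFin \o advection).
Proof.
have [M M0 [_ vx _ _]] := phi_box.
have mpd : measurable_fun setT (fun t => pos t * drt t).
  by apply: measurable_funM => //; exact: continuous_measurable_fun.
have pd1 t : `|pos t * drt t| <= c0.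
  by rewrite normrM -[X in _ <= X]mul1r; exact: ler_pM.
have intq := moment_integrable _ _ _ s_gt0 intP P_supp.
exact: (curve_weight_integrable _ _ _ crt _ _ _ _ _ mpd pd1 intq cphix vx).
Qed.

Let diffusion_integrable : mu.-integrable setT (EFin \o diffusion).
Proof.
have [M M0 [_ _ _ vxx]] := phi_box.
exact: (curve_weight_integrable _ _ _ crt _ _ _ _ _ mpos pos1 intP cphixx vxx).
Qed.

Let slice_patch :
  (fun t => atten_slice T tau0 D0 ell rho r t (fun x => phi x t)) \_ `]0, +oo[ =
  fun t => -1 * advection t + D0 * diffusion t.
Proof.
apply/funext => t; rewrite patchE mem_setE in_itv/= andbT.
rewrite /advection /diffusion /pos indicE mem_setE in_itv/= andbT.
have zero (d i j : R) : 0 = -1 * (0 * d * i) + D0 * (0 * j) by ring.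
case: ifPn => t0; last exact: zero.
by rewrite atten_slice_scaled// !mul1r mulN1r -mulNr.
Qed.

Let advectionZ : mu.-integrable setT (EFin \o (fun t => -1 * advection t)).
Proof. exact: (integrableZl measurableT (-1) advection_integrable). Qed.

Let diffusionZ : mu.-integrable setT (EFin \o (fun t => D0 * diffusion t)).
Proof. exact: (integrableZl measurableT D0 diffusion_integrable). Qed.

Lemma atten_slice_integrable : mu.-integrable `]0, +oo[
  (fun t => (atten_slice T tau0 D0 ell rho r t (fun x => phi x t))%:E).
Proof.
rewrite integrable_mkcond// -[X in X \_ _]/(EFin \o _) restrict_EFin
  slice_patch.
by have := integrableD measurableT advectionZ diffusionZ; apply: eq_integrable.
Qed.

(** The diffusion terms of both sides are equal, and what remains is
    [transport_identity], in which [P] has total mass [1]. *)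
Lemma gen_gauss_equation :
  dist_dt (regular_dist (gen_gauss T rho r)) phi
    - D0 * dist_dx (dist_dx (regular_dist (gen_gauss T rho r))) phi
  = dirac_origin phi - atten_dist T tau0 D0 ell rho r phi.
Proof.
have [M M0 [v vx vt vxx]] := phi_box; have [dx dt _] := phi_derivable.
have -> : atten_dist T tau0 D0 ell rho r phi =
    -1 * \int[mu]_t advection t + D0 * \int[mu]_t diffusion t.
  rewrite /atten_dist Rintegral_mkcond slice_patch.
  apply: etrans (RintegralD measurableT advectionZ diffusionZ) _.
  by congr (_ + _); [exact: (RintegralZl (-1) measurableT advection_integrable)|
    exact: (RintegralZl D0 measurableT diffusion_integrable)].
have := transport_identity _ _ _ _ _ _ s_gt0 intP P_supp crt cdrt derive_rt rt0
  drt_le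
  phi M M0 v cphi dx dt cphix cphit.
rewrite P_mass mulr1 => transp.
rewrite /dist_dt /dist_dx /dirac_origin opprK.
rewrite (pairing _ M cphit vt) (pairing _ M cphixx vxx).
rewrite -[X in D0 * X]/(\int[mu]_t diffusion t) mulN1r opprD opprK addrA;
  congr (_ - _).
by apply/eqP; rewrite -subr_eq -[phi 0 0]opprK -transp opprD.
Qed.

End test.

(** Local integrability is integrability of the product with the indicator
    function of a compact set, which is bounded by an integrable function of
    time. *)
Lemma gen_gauss_locally_integrable : locally_integrable2 (gen_gauss T rho r).
Proof.
rewrite gaussE; split; first exact: kernel_measurable.
move=> K cK; have mK := compact_measurable_prod _ _ cK.
have /compact_bounded[B [_ KB]] := cK.
pose M := `|B| + 1; pose b : R -> R := \1_(`[(- M), M]%classic : set R).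
have intb : mu.-integrable setT (EFin \o b) :=
  integrable_indic_itv (- M) M true false.
have Kb x t : `|(\1_K : R * R -> R) (x, t)| <= b t.
  rewrite /b !indicE mem_setE in_itv/= -ler_norml;
    have [|_] := boolP ((x, t) \in K).
    rewrite inE => /(KB M); rewrite ltr_pwDr ?ler_norm// => /(_ isT)/=.
    by rewrite prod_normE/= ge_max => /andP[_ ->]; rewrite normr1.
  by rewrite normr0.
have mKi : measurable_fun setT (\1_K : R * R -> R) by exact: measurable_indic.
have /integrableP[_] := kernel_integrable _ P k intP mk k_gt0 k0 _ b mKi intb
  Kb.
rewrite [X in (X < _)%E -> _](_ : _ =
  \int[(mu \x mu)%E]_(p in K) `|P (k p.2 * p.1) * k p.2|%:E)%E//.
rewrite [RHS]integral_mkcond; apply: eq_integral => p _.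
rewrite /= patchE indicE; case: (p \in K) => /=; first by rewrite mulr1.
by rewrite mulr0 normr0.
Qed.

Lemma composites_locally_integrable t : 0 < t ->
  locally_integrable setT (fun x => rho (similarity T r x t ^+ 2)) /\
  locally_integrable setT (fun x => ell (similarity T r x t ^+ 2)).
Proof.
move=> t0; have a0 : 0 < (s / r t) ^+ 2 by rewrite exprn_gt0// divr_gt0// r_gt0.
split.
- have := relaxation_square_locally_integrable _ _ _ _ _ ((s / r t) ^+ 2) T_gt0
    rho_relaxation.
  by congr locally_integrable; apply/funext => x; rewrite similarity_sqE.
- have := control_square_locally_integrable _ _ _ _ _ ell_control a0.
  by congr locally_integrable; apply/funext => x; rewrite similarity_sqE.
Qed.

End pulse.

(** * A radius function for which [coef_a0] vanishes *)

(** From [t0] on, [r ^+ 2] is linear with slope [4 * T * D0], so that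
    [r * r' = 2 * T * D0]; at [t0] this follows by continuity of [r']. *)
Lemma coef_a0_eq0 (R : realType) (T D0 t0 : R) (rho r dr : R -> R) :
  0 < T -> 0 < D0 -> 0 < t0 -> C1_halfline r dr ->
  (forall t, 0 <= t ->
     r t = if t <= t0
           then Num.sqrt (D0 * T / t0 ^+ 3) * (- t ^+ 2 + 3 * t0 * t)
           else Num.sqrt (4 * T * D0 * t)) ->
  forall x t, t0 <= t -> coef_a0 T 1 D0 rho r x t = 0.
Proof.
move=> T0 D00 t00 [cdr drE _] rE x t t0t.
have c4 : 0 < 4 * T * D0 by rewrite !mulr_gt0.
(* At t0 the quadratic formula applies, and its square is 4 * T * D0 * t0. *)
have rsq u : t0 <= u -> r u ^+ 2 = 4 * T * D0 * u /\ 0 < r u.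
  rewrite le_eqVlt => /predU1P[<-|t0u]; last first.
    have u0 : 0 < u by exact: lt_trans t0u.
    rewrite (rE _ (ltW u0)) leNgt t0u/= sqr_sqrtr;
      last by rewrite ltW// mulr_gt0.
    split => //.
    by rewrite sqrtr_gt0 mulr_gt0.
  have d0 : 0 < D0 * T / t0 ^+ 3 by rewrite divr_gt0 ?mulr_gt0 ?exprn_gt0.
  have q0 : - t0 ^+ 2 + 3 * t0 * t0 = 2 * t0 ^+ 2 by ring.
  rewrite (rE _ (ltW t00)) lexx q0; split;
    last by rewrite mulr_gt0 ?sqrtr_gt0// mulr_gt0// exprn_gt0.
  rewrite exprMn sqr_sqrtr; last exact: ltW.
  by field; rewrite gt_eqF.
have rdr u : t0 < u -> r u * dr u = 2 * T * D0.
  move=> t0u; have u0 : 0 < u by exact: lt_trans t0u.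
  have dr2 : is_derive u 1 (fun v => r v * r v) (4 * T * D0).
    have lin : is_derive u 1 (fun v => 4 * T * D0 * v) (4 * T * D0).
      apply: (is_derive_quadratic _ _ 0) => h.
      have -> : 4 * T * D0 * (u + h) - 4 * T * D0 * u - 4 * T * D0 * h = 0 by
        ring.
      by rewrite normr0 mul0r.
    move: lin; apply: near_eq_is_derive; near=> v.
    by rewrite -expr2 (rsq v _).1// ltW//; near: v; exact: lt_nbhsr.
  have := is_deriveM (drE _ u0) (drE _ u0) => h2.
  have e : r u *: dr u + r u *: dr u = 4 * T * D0.
    by rewrite -(@derive_val _ _ _ _ _ _ _ h2) (@derive_val _ _ _ _ _ _ _ dr2).
  have {e} : r u * dr u + r u * dr u = 4 * T * D0 by [].
  by move=> ?; lra.
(* The derivative at t0 is the limit of the derivatives from the right. *)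
have rdr0 : r t * dr t = 2 * T * D0.
  move: t0t; rewrite le_eqVlt => /predU1P[<-|]; last exact: rdr.
  have cr : r u @[u --> t0] --> r t0.
    by case: (drE _ t00) => h _;
      exact/differentiable_continuous/derivable1_diffP.
  have cd : dr u @[u --> t0] --> dr t0.
    case/continuous_within_itvcyP : cdr => c _.
    by apply: c; rewrite in_itv/= t00.
  have lim1 : r u * dr u @[u --> t0^'+] --> r t0 * dr t0.
    by apply: cvg_at_right_filter; exact: cvgM.
  have lim2 : r u * dr u @[u --> t0^'+] --> 2 * T * D0.
    apply/cvgrPdist_le => e e0; near=> u.
    rewrite rdr; first by rewrite subrr normr0 ltW.
    by near: u; exact: nbhs_right_gt.
  by apply: (cvg_unique _ lim1 lim2) => //; exact: Rhausdorff.
have t_gt0 : 0 < t by exact: lt_le_trans t0t.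
have rt0 := (rsq _ t0t).2.
rewrite /coef_a0 derive1E (@derive_val _ _ _ _ _ _ _ (drE _ t_gt0)) mul1r.
have -> : 2 * T * D0 / r t = dr t by rewrite -rdr0 mulrAC divff ?mul1r// gt_eqF.
by rewrite subrr mulr0.
Unshelve. all: by end_near. Qed.

Theorem proposition4 (R : realType) (T tau0 D0 c0 : R) (ell rho r : R -> R)
    (T_gt0 : 0 < T) (tau0_gt0 : 0 < tau0) (D0_gt0 : 0 < D0) (c0_gt0 : 0 < c0)
    (ell_control : control_term T tau0 ell)
    (rho_relaxation : relaxation_function T tau0 ell rho)
    (N_defined : profile_integral T rho != 0)
    (r_radius : radius_function c0 r) :
  let G := gen_gauss T rho r in
  let L := atten_dist T tau0 D0 ell rho r in
  [/\ locally_integrable2 G,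
      atten_well_defined T tau0 D0 ell rho r,
      (forall phi, test_function phi ->
         dist_dt (regular_dist G) phi
           - D0 * dist_dx (dist_dx (regular_dist G)) phi
         = dirac_origin phi - L phi),
      (forall x t, t < 0 -> G x t = 0) &
      (tau0 = 1 -> forall t0, 0 < t0 ->
         (forall t, 0 <= t ->
            r t = if t <= t0
                  then Num.sqrt (D0 * T / t0 ^+ 3) * (- t ^+ 2 + 3 * t0 * t)
                  else Num.sqrt (4 * T * D0 * t)) ->
         forall x t, t0 <= t -> coef_a0 T tau0 D0 rho r x t = 0)].
Proof.
case: r_radius => _ r0 r_gt0 _ [dr drP dr_bound] G L; split.
- exact: gen_gauss_locally_integrable T_gt0 rho_relaxation r_gt0 drP.
- split=> [t t_gt0|phi phi_test].
    exact: composites_locally_integrable T_gt0 ell_control rho_relaxation r_gt0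
      t t_gt0.
  exact: atten_slice_integrable T_gt0 tau0_gt0 ell_control rho_relaxation r0
    r_gt0 drP dr_bound phi phi_test.
- move=> phi phi_test.
  exact: gen_gauss_equation T_gt0 tau0_gt0 ell_control rho_relaxation N_defined
    r0 r_gt0 drP dr_bound phi phi_test.
- by move=> x t t_lt0; rewrite /G /gen_gauss ltNge ltW.
- move=> -> t0 t0_gt0 rE x t t0t.
  exact: coef_a0_eq0 T_gt0 D0_gt0 t0_gt0 drP rE x t t0t.
Qed.
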